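(* Suppose that $\boldsymbol\gamma=\{\gamma_n\}_{n=0}^\infty$ is an H-indeterminate Hamburger moment sequence. Then exactly one of the following three conditions holds: (i) for every $\nu\in\mathscr M_e(\boldsymbol\gamma)$, $\inf\mathrm{supp}(\nu)=-\infty$ and $\sup\mathrm{supp}(\nu)=\infty$, (ii) for every $\nu\in\mathscr M_e(\boldsymbol\gamma)$, $\inf\mathrm{supp}(\nu)>-\infty$ and $\sup\mathrm{supp}(\nu)=\infty$, (iii) for every $\nu\in\mathscr M_e(\boldsymbol\gamma)$, $\inf\mathrm{supp}(\nu)=-\infty$ and $\sup\mathrm{supp}(\nu)<\infty$.
   Context: All measures are positive; $\mathrm{supp}(\nu)$ is the closed support of $\nu$. A real sequence $\{\gamma_n\}_{n=0}^\infty$ is a Hamburger moment sequence if there is a Borel measure $\nu$ on $\mathbb R$ with $\int|t|^n\,d\nu(t)<\infty$ and $\gamma_n=\int t^n\,d\nu(t)$ for all integers $n\ge0$; such $\nu$ are its H-representing measures. It is H-indeterminate if it has more than one H-representing measure. An H-representing measure $\nu$ of an H-indeterminate Hamburger moment sequence $\boldsymbol\gamma$ is N-extremal if the complex polynomials are dense in $L^2(\nu)$; $\mathscr M_e(\boldsymbol\gamma)$ is the set of all N-extremal measures of $\boldsymbol\gamma$. *)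

(* Defs.v *)
From HB Require Import structures.
From mathcomp Require Import all_boot all_order all_algebra.
From mathcomp Require Import all_classical all_reals all_analysis.
From mathcomp Require Import complex.

Set Implicit Arguments.
Unset Strict Implicit.
Unset Printing Implicit Defensive.

Import Order.TTheory GRing.Theory Num.Theory.
Import numFieldNormedType.Exports.

Local Open Scope classical_set_scope.
Local Open Scope ring_scope.
Local Open Scope complex_scope.

Notation borel_measure R := {measure set (measurableTypeR R) -> \bar (R%type)}.

Definition H_representing (R : realType) (gamma : nat -> R)
    (nu : borel_measure R) : Prop :=
  forall n : nat,
    (\int[nu]_t (`|t| ^+ n)%:E < +oo)%E /\
    ((gamma n)%:E = \int[nu]_t (t ^+ n)%:E)%E.

Definition Hamburger_moment_sequence (R : realType) (gamma : nat -> R) : Prop :=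
  exists nu : borel_measure R, H_representing gamma nu.

(* The type {measure set _ -> _} also records junk values on non-measurable
   sets, so two measures are compared on measurable sets only. *)
Definition H_indeterminate (R : realType) (gamma : nat -> R) : Prop :=
  exists nu1 nu2 : borel_measure R,
    [/\ H_representing gamma nu1, H_representing gamma nu2 &
        exists2 A : set (measurableTypeR R), measurable A & nu1 A <> nu2 A].

(* The L^2 seminorm of a complex-valued function; the modulus is taken in R by
   normc, since the norm `|z| of z : R[i] lives in R[i]. *)
Definition L2norm (R : realType) (nu : borel_measure R) (f : R -> R[i]) :
    \bar R :=
  Lnorm nu 2%:E (fun t => (ComplexField.Normc.normc (f t))%:E).

(* L^2(nu), as functions rather than classes. There is no measurableType on
   R[i]: Borel measurability amounts to that of the real and imaginary parts. *)
Definition complex_L2 (R : realType) (nu : borel_measure R)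
    (f : R -> R[i]) : Prop :=
  [/\ measurable_fun [set: measurableTypeR R] (fun t => complex.Re (f t)),
      measurable_fun [set: measurableTypeR R] (fun t => complex.Im (f t)) &
      (L2norm nu f < +oo)%E].

Definition poly_fun (R : realType) (p : {poly R[i]}) (t : R) : R[i] :=
  p.[t%:C].

Definition polynomials_dense_L2 (R : realType) (nu : borel_measure R) : Prop :=
  (forall p : {poly R[i]}, complex_L2 nu (poly_fun p)) /\
  (forall f : R -> R[i], complex_L2 nu f ->
     forall eps : R, 0 < eps ->
     exists p : {poly R[i]},
       (L2norm nu (fun t => f t - poly_fun p t)%R < eps%:E)%E).

Definition N_extremal (R : realType) (gamma : nat -> R) :
    set (borel_measure R) :=
  [set nu | [/\ H_indeterminate gamma, H_representing gamma nu &
                polynomials_dense_L2 nu]].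

Definition supp (R : realType) (nu : borel_measure R) : set R :=
  [set x | forall U : set R, open U -> U x -> (0 < nu U)%E].

(* Infimum and supremum in the extended reals. *)
Definition inf_supp (R : realType) (nu : borel_measure R) : \bar R :=
  ereal_inf (EFin @` supp nu).

Definition sup_supp (R : realType) (nu : borel_measure R) : \bar R :=
  ereal_sup (EFin @` supp nu).

Definition exactly_one_of_three (P Q S : Prop) : Prop :=
  [/\ [\/ P, Q | S], ~ (P /\ Q), ~ (P /\ S) & ~ (Q /\ S)].

(* Main.v *)
Require Import Defs.
From HB Require Import structures.
From mathcomp Require Import all_boot all_order all_algebra.
From mathcomp Require Import all_classical all_reals all_analysis.
From mathcomp Require Import measurable_realfun complex ring lra.

(** Let [L] be the moment functional on real polynomials. For any representing
    measure the seminorm [L (p ^ 2)] is the squared L^2-norm of [p], so every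
    estimate between such norms may be proved with one representing measure and
    used with another one.

    Indeterminacy bounds the value of [p] at the imaginary unit by the norm of
    [p]. Otherwise the resolvents [1 / (t - i)] and [1 / (t + i)] are L^2-limits
    of polynomials for the sum of two representing measures, hence so is the
    algebra that they generate; this algebra contains functions that converge
    boundedly to the indicator functions of half-lines, so the two measures
    agree ([determinate_of_unbounded_remainder]). Complex numbers are avoided:
    the value of [p] at [i] is recorded by the remainder of [p] modulo
    [X ^ 2 + 1]. The quotient by [X ^ 2 + 1] is then a Hilbert-Schmidt operator
    which is triangular in the orthonormal polynomials [P n], and a Gronwall
    argument carries the bound from [i] to the real line: the kernels
    [\sum_(k < n) (P k).[x] * (P k).[y]] are bounded and Lipschitz, locally in
    [x] and [y] and uniformly in [n] ([Kdiag_bounded], [kernel_Lipschitz]).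

    An N-extremal measure exists: [L] is integrated on polynomials of size at
    most [n] by the Gauss quadrature on the roots of [P n], whose masses are
    [1 / Kdiag P n x]. By the kernel bounds these masses are locally bounded
    below and the nodes are locally separated, so along an ultrafilter the
    quadratures converge to an atomic measure with mass
    [1 / Kdiag_lim P x] at [x]. This is the largest mass that the Christoffel
    function allows, which makes the indicator function of every atom an
    L^2-limit of polynomials ([exists_N_extremal]).

    Two N-extremal measures are semibounded on the same sides
    ([N_extremal_negative_part]): if [nu] lives on [[a, +oo[] and [x0 < a], then
    [L ((X - x0) * r ^ 2)] is nonnegative for every [r]. Polynomials vanishing at
    [x0] have codimension one, so if an N-extremal [mu] charged two disjoint
    sets to the left of [x0], some combination [f] of their indicator functions
    would satisfy [(t - x0) f = lim (t - x0) r] in L^2 of [mu] with polynomials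
    [r]; then [L ((X - x0) * r ^ 2)] would tend to the negative number
    [\int (t - x0) f ^ 2]. Finally no representing measure has bounded support
    ([unbounded_supp]), because point evaluations are bounded. The three
    alternatives follow, and existence makes them exclusive. *)

Set Implicit Arguments.
Unset Strict Implicit.
Unset Printing Implicit Defensive.
Import Order.TTheory GRing.Theory Num.Theory.
Import numFieldNormedType.Exports.
Local Open Scope classical_set_scope.
Local Open Scope ring_scope.

(** * Positive functionals on polynomials *)

Section PositiveFunctional.
Variables (R : realType) (L : {scalar {poly R}}).
Hypothesis L_pos : forall p : {poly R}, p != 0 -> 0 < L (p ^+ 2).

Let LD (p q : {poly R}) : L (p + q) = L p + L q. Proof. exact: linearD. Qed.
Let LN (p : {poly R}) : L (- p) = - L p. Proof. exact: linearN. Qed.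
Let LZ c (p : {poly R}) : L (c *: p) = c * L p. Proof. exact: linearZ. Qed.

Lemma L_sqr_ge0 (p : {poly R}) : 0 <= L (p ^+ 2).
Proof.
have [->|p0] := eqVneq p 0; last exact/ltW/L_pos.
by rewrite expr0n/= linear0.
Qed.

Lemma L_sqrZ c (p : {poly R}) : L ((c *: p) ^+ 2) = c ^+ 2 * L (p ^+ 2).
Proof. by rewrite exprZn LZ. Qed.

Lemma L_sqrD_le (p q : {poly R}) : L ((p + q) ^+ 2) <= 2 * L (p ^+ 2) + 2 * L (q ^+ 2).
Proof.
have := L_sqr_ge0 (p - q).
have -> : (p - q) ^+ 2 = 2 *: p ^+ 2 + 2 *: q ^+ 2 + - (p + q) ^+ 2.
  by rewrite !scaler_nat; ring.
by rewrite !LD !LZ LN; lra.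
Qed.

Lemma L_CauchySchwarz (p q : {poly R}) : L (p * q) ^+ 2 <= L (p ^+ 2) * L (q ^+ 2).
Proof.
have [->|q0] := eqVneq q 0.
  by rewrite mulr0 expr0n/= linear0 expr0n/= mulr0.
have Lq := L_pos q0.
have := L_sqr_ge0 (L (q ^+ 2) *: p - L (p * q) *: q).
have -> : (L (q ^+ 2) *: p - L (p * q) *: q) ^+ 2 =
   L (q ^+ 2) ^+ 2 *: p ^+ 2 + - ((2 * L (q ^+ 2) * L (p * q)) *: (p * q))
   + L (p * q) ^+ 2 *: q ^+ 2.
  rewrite -!mul_polyC !(polyCM, polyC_exp, polyC_natr); ring.
rewrite !LD LN !LZ.
set a := L (q ^+ 2) in Lq *; set b := L (p ^+ 2); set c := L (p * q).
have -> : a ^+ 2 * b - 2 * a * c * c + c ^+ 2 * a = a * (b * a - c ^+ 2) by ring.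
by rewrite pmulr_rge0// subr_ge0.
Qed.

(** Gram-Schmidt, one degree at a time: [e] is the part of ['X^n] that is
    orthogonal to all lower degrees. *)
Lemma L_projection n (f : {poly R}) : exists2 g : {poly R}, (size g <= n)%N &
  forall q : {poly R}, (size q <= n)%N -> L ((f - g) * q) = 0.
Proof.
elim: n f => [|n IH] f.
  exists 0; rewrite ?size_poly0// => q; rewrite leqn0 size_poly_eq0 => /eqP ->.
  by rewrite mulr0 linear0.
have [g sg gP] := IH f; have [h sh hP] := IH 'X^n.
pose e : {poly R} := 'X^n - h.
have se : size e = n.+1 by rewrite size_polyDl ?size_polyN ?size_polyXn.
have e0 : e != 0 by rewrite -size_poly_eq0 se.
pose c := L ((f - g) * e) / L (e ^+ 2).
exists (g + c *: e).
  rewrite (leq_trans (size_polyD _ _))// geq_max (leq_trans sg)//=.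
  by rewrite (leq_trans (size_scale_leq _ _))// se.
move=> q sq; pose ql : {poly R} := q - q`_n *: 'X^n.
have sql : (size ql <= n)%N.
  apply/leq_sizeP => j; rewrite leq_eqVlt => /predU1P[<-|nj].
    by rewrite coefB coefZ coefXn eqxx mulr1 subrr.
  rewrite coefB coefZ coefXn gtn_eqF// mulr0 subr0 nth_default//.
  by rewrite (leq_trans sq).
have -> : q = q`_n *: e + (q`_n *: h + ql).
  by rewrite /ql /e scalerBr addrA subrK addrC subrK.
set l : {poly R} := _ + ql.
have sl : (size l <= n)%N.
  rewrite (leq_trans (size_polyD _ _))// geq_max sql andbT.
  by rewrite (leq_trans (size_scale_leq _ _)).
have -> : (f - (g + c *: e)) * (q`_n *: e + l) =
  q`_n *: ((f - g) * e) - (q`_n * c) *: (e ^+ 2)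
  + ((f - g) * l - c *: (e * l)).
  rewrite -!mul_polyC polyCM; ring.
rewrite 2!LD !LN !LZ LD LN LZ (gP l)// (hP l : _ -> L (e * l) = 0)// mulr0 subr0 addr0 /c.
by rewrite -mulrA divfK ?gt_eqF ?L_pos// subrr.
Qed.

Definition orthonormal_polys (P : nat -> {poly R}) :=
  forall n, [/\ size (P n) = n.+1, L (P n ^+ 2) = 1 &
    forall q : {poly R}, (size q <= n)%N -> L (P n * q) = 0].

Lemma exists_orthonormal_polys : exists P, orthonormal_polys P.
Proof.
suff /choice[P PP] : forall n, exists p : {poly R},
    [/\ size p = n.+1, L (p ^+ 2) = 1 &
    forall q : {poly R}, (size q <= n)%N -> L (p * q) = 0] by exists P.
move=> n.
have [h sh hP] := L_projection n 'X^n.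
pose e : {poly R} := 'X^n - h.
have se : size e = n.+1 by rewrite size_polyDl ?size_polyN ?size_polyXn.
have e0 : e != 0 by rewrite -size_poly_eq0 se.
have Le := L_pos e0.
exists ((Num.sqrt (L (e ^+ 2)))^-1 *: e); split.
- by rewrite size_scale ?se// invr_eq0 sqrtr_eq0 -ltNge.
- by rewrite L_sqrZ exprVn sqr_sqrtr ?ltW// mulVf// gt_eqF.
- by move=> q sq; rewrite -scalerAl LZ (hP q sq : L (e * q) = 0) mulr0.
Qed.

Section Orthonormal.
Variable P : nat -> {poly R}.
Hypothesis PP : orthonormal_polys P.

Lemma size_orthonormal n : size (P n) = n.+1. Proof. by have [] := PP n. Qed.
Lemma L_orthonormal_sqr n : L (P n ^+ 2) = 1. Proof. by have [] := PP n. Qed.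
Lemma L_orthonormal_low n (q : {poly R}) : (size q <= n)%N -> L (P n * q) = 0.
Proof. by have [_ _] := PP n; apply. Qed.

Lemma L_orthonormal_pair i j : L (P i * P j) = (i == j)%:R.
Proof.
have [ij|ji|->] := ltngtP i j; last by rewrite -expr2 L_orthonormal_sqr.
  by rewrite mulrC L_orthonormal_low// size_orthonormal.
by rewrite L_orthonormal_low// size_orthonormal.
Qed.

Lemma L_orthonormal_mulsum n (c : nat -> R) i :
  L (P i * \sum_(k < n) c k *: P k) = if (i < n)%N then c i else 0.
Proof.
rewrite mulr_sumr linear_sum/=.
under eq_bigr do rewrite -scalerAr LZ L_orthonormal_pair.
case: ltnP => [lin|nli].
  rewrite (bigD1 (Ordinal lin))//= eqxx mulr1 big1 ?addr0// => k ki.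
  rewrite (_ : (i == k) = false) ?mulr0//.
  by apply: contraNF ki => /eqP ik; apply/eqP/val_inj.
rewrite big1// => k _; rewrite gtn_eqF ?mulr0//.
by rewrite (leq_trans _ nli).
Qed.

Lemma size_orthonormal_sum n (c : nat -> R) : (size (\sum_(k < n) c k *: P k)%R <= n)%N.
Proof.
apply: (leq_trans (size_sum _ _ _)); apply/bigmax_leqP => i _.
by rewrite (leq_trans (size_scale_leq _ _))// size_orthonormal.
Qed.

(** A polynomial of size at most [n] orthogonal to [P k] for all [k < n] is
    zero, since it pairs nontrivially with the [P m] of its own size. *)
Lemma orthonormal_expansion n (q : {poly R}) : (size q <= n)%N ->
  q = \sum_(k < n) L (P k * q) *: P k.
Proof.
move=> sq; set s := \sum_(k < n) _.
pose d : {poly R} := q - s.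
have sd : (size d <= n)%N.
  rewrite (leq_trans (size_polyD _ _))// geq_max sq/= size_polyN.
  exact: (size_orthonormal_sum _ (fun k => L (P k * q))).
have dP k : (k < n)%N -> L (P k * d) = 0.
  move=> kn; rewrite mulrBr LD LN (L_orthonormal_mulsum _ (fun k => L (P k * q))) kn.
  by rewrite subrr.
suff : d = 0 by move=> /eqP; rewrite subr_eq0 => /eqP.
apply/eqP; apply: contraT => d0.
have sd0 : (0 < size d)%N by rewrite lt0n size_poly_eq0.
set m := (size d).-1.
have sdm : size d = m.+1 by rewrite prednK.
have mn : (m < n)%N by rewrite -sdm.
pose c := lead_coef d / lead_coef (P m).
have Pm0 : P m != 0 by rewrite -size_poly_eq0 size_orthonormal.
have lP0 : lead_coef (P m) != 0 by rewrite lead_coef_eq0.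
have c0 : c != 0 by rewrite mulf_neq0 ?invr_eq0// lead_coef_eq0.
have sr : (size (d - c *: P m)%R <= m)%N.
  apply/leq_sizeP => j; rewrite leq_eqVlt => /predU1P[<-|mj].
    rewrite coefB coefZ.
    have -> : d`_m = lead_coef d by rewrite /lead_coef sdm.
    have -> : (P m)`_m = lead_coef (P m) by rewrite /lead_coef size_orthonormal.
    by rewrite divfK// subrr.
  by rewrite coefB coefZ !nth_default ?mulr0 ?subrr ?size_orthonormal ?sdm.
have := dP m mn.
have -> : P m * d = P m * (d - c *: P m) + c *: P m ^+ 2.
  by rewrite -!mul_polyC; ring.
rewrite LD LZ L_orthonormal_low// L_orthonormal_sqr mulr1 add0r => /eqP.
by rewrite (negbTE c0).
Qed.

Lemma L_parseval n (q : {poly R}) : (size q <= n)%N ->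
  L (q ^+ 2) = \sum_(k < n) L (P k * q) ^+ 2.
Proof.
move=> sq; rewrite expr2 {1}(orthonormal_expansion sq) mulr_suml linear_sum/=.
by apply: eq_bigr => k _; rewrite -scalerAl LZ expr2.
Qed.

Lemma horner_orthonormal_expansion n (q : {poly R}) x : (size q <= n)%N ->
  q.[x] = \sum_(k < n) L (P k * q) * (P k).[x].
Proof.
move=> sq; rewrite {1}(orthonormal_expansion sq) horner_sum.
by apply: eq_bigr => k _; rewrite hornerZ.
Qed.

(** A functional bounded in the seminorm of [L] is square summable along an
    orthonormal system (test it on the truncations of its own Riesz
    representative). *)
Lemma bounded_functional_l2 (phi : {scalar {poly R}}) C :
  (forall p, phi p ^+ 2 <= C * L (p ^+ 2)) ->
  forall n, \sum_(k < n) phi (P k) ^+ 2 <= C.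
Proof.
move=> phiC n; set S := \sum_(k < n) _.
have S0 : 0 <= S by apply: sumr_ge0 => k _; exact: sqr_ge0.
have C0 : 0 <= C.
  by have := phiC (P 0); rewrite L_orthonormal_sqr mulr1; apply: le_trans; exact: sqr_ge0.
pose p : {poly R} := \sum_(k < n) phi (P k) *: P k.
have phip : phi p = S.
  by rewrite linear_sum/=; apply: eq_bigr => k _; rewrite linearZ/= expr2.
have Lp : L (p ^+ 2) = S.
  rewrite (L_parseval (size_orthonormal_sum n (fun k => phi (P k)))).
  apply: eq_bigr => k _.
  by rewrite (L_orthonormal_mulsum _ (fun k => phi (P k))) ltn_ord.
have := phiC p; rewrite phip Lp expr2.
have [->//|Sn0] := eqVneq S 0.
by rewrite ler_pM2r// lt_neqAle eq_sym Sn0.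
Qed.

End Orthonormal.
End PositiveFunctional.
(** * Division by X^2 + 1 *)

(** A discrete Gronwall inequality: [1 + x <= expR x] turns the recursion for
    the partial sums of [v ^ 2] into an exponential bound. *)
Lemma gronwall_squares (R : realType) (u v B : nat -> R) (M : R) :
  0 <= M -> (forall n, 0 <= B n) ->
  (forall n, v n ^+ 2 <= 2 * u n ^+ 2 + 2 * M * B n * \sum_(k < n) v k ^+ 2) ->
  forall n, \sum_(k < n) v k ^+ 2 <=
    2 * (\sum_(k < n) u k ^+ 2) * expR (2 * M * \sum_(k < n) B k).
Proof.
move=> M0 B0 H; elim=> [|n IH]; first by rewrite !big_ord0 !mulr0 mul0r.
rewrite !big_ord_recr/=.
set V := \sum_(k < n) v k ^+ 2 in IH *; set U := \sum_(k < n) u k ^+ 2 in IH *.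
set S := \sum_(k < n) B k in IH *.
have S0 : 0 <= S by apply: sumr_ge0.
have U0 : 0 <= U by apply: sumr_ge0 => k _; exact: sqr_ge0.
have MB0 : 0 <= 2 * M * B n by rewrite !mulr_ge0.
apply: (@le_trans _ _ (V * (1 + 2 * M * B n) + 2 * u n ^+ 2)).
  by have := H n; rewrite -/V; lra.
apply: (@le_trans _ _ (V * expR (2 * M * B n) + 2 * u n ^+ 2)).
  rewrite lerD2r ler_wpM2l ?expR_ge1Dx//.
  by apply: sumr_ge0 => k _; exact: sqr_ge0.
have -> : 2 * M * (S + B n) = 2 * M * S + 2 * M * B n by ring.
rewrite mulrDr mulrDl lerD//.
  by rewrite expRD mulrA ler_wpM2r ?expR_ge0.
apply: ler_peMr; first by rewrite mulr_ge0 ?sqr_ge0.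
by rewrite -[leLHS]expR0 ler_expR addr_ge0// !mulr_ge0.
Qed.

Section DivisionByQuadratic.
Variable R : realType.

(** Division by [X ^ 2 + 1] is evaluation at the imaginary unit [i] in real
    terms: the value of [p] at [i] is [rem1 p * i + rem0 p], and [quo] is the
    divided difference of [p] at [i] and [- i]. *)
Definition quadr : {poly R} := 'X^2 + 1%:P.
Definition rem0 (p : {poly R}) : R := (p %% quadr)`_0.
Definition rem1 (p : {poly R}) : R := (p %% quadr)`_1.
Definition quo (p : {poly R}) : {poly R} := p %/ quadr.

Lemma size_quadr : size quadr = 3%N.
Proof. by rewrite /quadr size_polyDl ?size_polyXn ?size_polyC ?oner_eq0. Qed.

Lemma quadr_neq0 : quadr != 0.
Proof. by rewrite -size_poly_eq0 size_quadr. Qed.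

Lemma quadr_divE p : p = quo p * quadr + (rem1 p *: 'X + (rem0 p)%:P).
Proof.
rewrite {1}(divp_eq p quadr); congr (_ + _).
apply/polyP => i; rewrite coefD coefZ coefX coefC.
case: i => [|[|i]]/=; rewrite ?mulr0 ?mulr1 ?add0r ?addr0//.
rewrite nth_default// (@leq_trans 2)// -ltnS -size_quadr ltn_modp.
exact: quadr_neq0.
Qed.

Lemma quadr_divE_uniq (p q : {poly R}) a b :
  p = q * quadr + (a *: 'X + b%:P) -> [/\ quo p = q, rem1 p = a & rem0 p = b].
Proof.
have s2 : (size (a *: 'X + b%:P)%R < size quadr)%N.
  rewrite size_quadr ltnS (leq_trans (size_polyD _ _))// geq_max.
  rewrite (leq_trans (size_scale_leq _ _)) ?size_polyX//=.
  by rewrite size_polyC (leq_trans (leq_b1 _)).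
move=> ->; rewrite /quo /rem1 /rem0 divp_addl_mul_small ?modp_addl_mul_small//.
by rewrite !coefD !coefZ !coefX !coefC/= !mulr1 !addr0 !mulr0 add0r.
Qed.

Lemma quo_linear a (p q : {poly R}) : quo (a *: p + q) = a *: quo p + quo q.
Proof. by rewrite /quo divpD divpZl. Qed.

Lemma rem0_linear a (p q : {poly R}) : rem0 (a *: p + q) = a * rem0 p + rem0 q.
Proof. by rewrite /rem0 modpD modpZl coefD coefZ. Qed.

Lemma rem1_linear a (p q : {poly R}) : rem1 (a *: p + q) = a * rem1 p + rem1 q.
Proof. by rewrite /rem1 modpD modpZl coefD coefZ. Qed.

Lemma size_quo (p : {poly R}) : (size (quo p) <= (size p).-1)%N.
Proof.
rewrite size_divp ?quadr_neq0// size_quadr.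
by case: (size p) => // n; rewrite leq_subLR addnC addn2.
Qed.

End DivisionByQuadratic.
(** * Local bounds on the reproducing kernels *)

Section LocalBounds.
Variables (R : realType) (L : {scalar {poly R}}) (C : R).
Hypothesis L_sqr_ge0 : forall p : {poly R}, 0 <= L (p ^+ 2).
Hypothesis L1_pos : 0 < L 1.
Hypothesis rem_bounded : forall p : {poly R},
  rem0 p ^+ 2 + rem1 p ^+ 2 <= C * L (p ^+ 2).

Let LD (p q : {poly R}) : L (p + q) = L p + L q. Proof. exact: linearD. Qed.
Let LN (p : {poly R}) : L (- p) = - L p. Proof. exact: linearN. Qed.
Let LZ c (p : {poly R}) : L (c *: p) = c * L p. Proof. exact: linearZ. Qed.

Lemma L_sqr_quadr (q : {poly R}) :
  L (q ^+ 2) + L (('X * q) ^+ 2) <= L ((q * quadr R) ^+ 2).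
Proof.
have -> : (q * quadr R) ^+ 2 = q ^+ 2 + ('X * q) ^+ 2 + (('X * q) ^+ 2 + ('X^2 * q) ^+ 2).
  by rewrite /quadr; ring.
by rewrite !LD lerDl addr_ge0.
Qed.

(** Positive definiteness: a polynomial of least size in the kernel of the
    seminorm has zero remainder, and its quotient is again in the kernel. *)
Lemma L_pos_of_rem_bounded (p : {poly R}) : p != 0 -> 0 < L (p ^+ 2).
Proof.
move=> p0; rewrite lt_neqAle L_sqr_ge0 andbT eq_sym.
have [n] := ubnP (size p); elim: n p p0 => // n IH p p0 spn.
apply/negP => /eqP Lp.
have := rem_bounded p; rewrite Lp mulr0 => rp.
have r0 : rem0 p = 0.
  by apply/eqP; rewrite -sqrf_eq0 eq_le sqr_ge0 andbT; move: rp; have := sqr_ge0 (rem1 p); lra.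
have r1 : rem1 p = 0.
  by apply/eqP; rewrite -sqrf_eq0 eq_le sqr_ge0 andbT; move: rp; have := sqr_ge0 (rem0 p); lra.
have pE := quadr_divE p.
rewrite r0 r1 scale0r !addr0 in pE.
have q0 : quo p != 0 by apply: contra_neq p0 => q0; rewrite pE q0 mul0r.
have sq : (size (quo p) < n)%N.
  have sp : (0 < size p)%N by rewrite lt0n size_poly_eq0.
  by rewrite (leq_ltn_trans (size_quo p))// -ltnS prednK.
have := IH _ q0 sq; apply/negP; rewrite negbK eq_le L_sqr_ge0 andbT.
have := L_sqr_quadr (quo p); rewrite -pE Lp.
by have := L_sqr_ge0 ('X * quo p); lra.
Qed.
Let L_pos := L_pos_of_rem_bounded.

Definition remM : R := 2 * C * (L ('X ^+ 2) + L 1).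
Definition quoC : R := L 1 * (2 + 2 * remM).

Lemma rem_bound_ge0 : 0 <= C.
Proof.
have := rem_bounded 1; rewrite expr1n => h.
rewrite -(pmulr_rge0 C L1_pos) mulrC; apply: le_trans h.
by rewrite addr_ge0 ?sqr_ge0.
Qed.

Lemma L_sqr_rem (p : {poly R}) :
  L ((rem1 p *: 'X + (rem0 p)%:P) ^+ 2) <= remM * L (p ^+ 2).
Proof.
have LX0 := L_sqr_ge0 'X.
apply: (le_trans (L_sqrD_le L_pos _ _)).
rewrite (L_sqrZ L) -[(rem0 p)%:P]alg_polyC (L_sqrZ L) expr1n.
apply: (@le_trans _ _ (2 * (rem0 p ^+ 2 + rem1 p ^+ 2) * (L ('X ^+ 2) + L 1))).
  have := mulr_ge0 (sqr_ge0 (rem0 p)) LX0.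
  by have := mulr_ge0 (sqr_ge0 (rem1 p)) (ltW L1_pos); lra.
have T0 : 0 <= L ('X ^+ 2) + L 1 by rewrite addr_ge0// ltW.
by have := ler_wpM2r T0 (rem_bounded p); rewrite /remM; lra.
Qed.

Lemma L_sqr_quo (p : {poly R}) :
  L 1 * (L (quo p ^+ 2) + L (('X * quo p) ^+ 2)) <= quoC * L (p ^+ 2).
Proof.
rewrite /quoC -mulrA ler_pM2l//.
apply: (le_trans (L_sqr_quadr _)).
have -> : quo p * quadr R = p + - (rem1 p *: 'X + (rem0 p)%:P).
  by rewrite {2}(quadr_divE p) addrK.
apply: (le_trans (L_sqrD_le L_pos _ _)).
by rewrite sqrrN; have := L_sqr_rem p; lra.
Qed.

Lemma L_quo_bounded (p : {poly R}) : L (quo p) ^+ 2 <= quoC * L (p ^+ 2).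
Proof.
apply: le_trans (L_sqr_quo p).
have := L_CauchySchwarz L_pos 1 (quo p); rewrite mul1r expr1n => h.
by apply: (le_trans h); rewrite ler_pM2l// lerDl.
Qed.

Lemma L_Xquo_bounded (p : {poly R}) :
  L ('X * quo p) ^+ 2 <= quoC * L (p ^+ 2).
Proof.
apply: le_trans (L_sqr_quo p).
have := L_CauchySchwarz L_pos 1 ('X * quo p); rewrite mul1r expr1n => h.
by apply: (le_trans h); rewrite ler_pM2l// lerDr.
Qed.

Variable P : nat -> {poly R}.
Hypothesis PP : orthonormal_polys L P.

Let l2_of phi (phi_lin : forall a (p q : {poly R}), phi (a *: p + q) = a * phi p + phi q) c
  (phi_bnd : forall p, phi p ^+ 2 <= c * L (p ^+ 2)) n :
  \sum_(k < n) phi (P k) ^+ 2 <= c.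
Proof.
pose f : {scalar {poly R}} :=
  HB.pack phi (GRing.isLinear.Build R {poly R} R *%R phi phi_lin).
exact: (bounded_functional_l2 PP (phi := f) phi_bnd).
Qed.

Lemma rem0_l2 n : \sum_(k < n) rem0 (P k) ^+ 2 <= C.
Proof.
apply: l2_of; first exact: rem0_linear.
by move=> p; apply: le_trans (rem_bounded p); rewrite lerDl sqr_ge0.
Qed.

Lemma rem1_l2 n : \sum_(k < n) rem1 (P k) ^+ 2 <= C.
Proof.
apply: l2_of; first exact: rem1_linear.
by move=> p; apply: le_trans (rem_bounded p); rewrite lerDr sqr_ge0.
Qed.

Lemma Lquo_l2 n : \sum_(k < n) L (quo (P k)) ^+ 2 <= quoC.
Proof.
apply: (@l2_of (fun p => L (quo p))) => [a p q|]; last exact: L_quo_bounded.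
by rewrite quo_linear LD LZ.
Qed.

Lemma LXquo_l2 n : \sum_(k < n) L ('X * quo (P k)) ^+ 2 <= quoC.
Proof.
apply: (@l2_of (fun p => L ('X * quo p))) => [a p q|].
  by rewrite quo_linear mulrDr -scalerAr LD LZ.
exact: L_Xquo_bounded.
Qed.

(** The matrix coefficients of [quo] in the basis [P]: orthogonality of [P n]
    to [quo (P k)] leaves an expression in the values on [P n] and [P k] of
    four bounded functionals. *)
Lemma L_quo_orthonormal n k : (k <= n)%N -> L (P k * quo (P n)) =
  rem1 (P k) * L ('X * quo (P n)) + rem0 (P k) * L (quo (P n))
  - (rem1 (P n) * L ('X * quo (P k)) + rem0 (P n) * L (quo (P k))).
Proof.
move=> kn.
have orth : L (P n * quo (P k)) = 0.
  apply: (L_orthonormal_low PP); apply: (leq_trans (size_quo _)).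
  by rewrite (size_orthonormal PP)/=.
have -> : P k * quo (P n) =
    P n * quo (P k)
    + (rem1 (P k) *: ('X * quo (P n)) + rem0 (P k) *: quo (P n)
       - (rem1 (P n) *: ('X * quo (P k)) + rem0 (P n) *: quo (P k))).
  rewrite {1}(quadr_divE (P k)) {2}(quadr_divE (P n)) -!mul_polyC; ring.
by rewrite LD orth add0r LD LN !LD !LZ.
Qed.

Let sq4 (a b c d : R) : (a + b - (c + d)) ^+ 2 <=
  4 * (a ^+ 2 + b ^+ 2 + c ^+ 2 + d ^+ 2).
Proof.
have := sqr_ge0 (a - b); have := sqr_ge0 (a + c); have := sqr_ge0 (a + d).
have := sqr_ge0 (b + c); have := sqr_ge0 (b + d); have := sqr_ge0 (c - d).
rewrite !expr2; lra.
Qed.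

Lemma L_sqr_quo_orthonormal n : L (quo (P n) ^+ 2) <=
  4 * (C * L ('X * quo (P n)) ^+ 2 + C * L (quo (P n)) ^+ 2
       + quoC * rem1 (P n) ^+ 2 + quoC * rem0 (P n) ^+ 2).
Proof.
have sn : (size (quo (P n)) <= n)%N.
  by rewrite (leq_trans (size_quo _))// (size_orthonormal PP).
rewrite (L_parseval PP sn).
apply: (@le_trans _ _ (\sum_(k < n) 4 *
   (rem1 (P k) ^+ 2 * L ('X * quo (P n)) ^+ 2
    + rem0 (P k) ^+ 2 * L (quo (P n)) ^+ 2
    + L ('X * quo (P k)) ^+ 2 * rem1 (P n) ^+ 2
    + L (quo (P k)) ^+ 2 * rem0 (P n) ^+ 2))).
  apply: ler_sum => k _; rewrite L_quo_orthonormal; last exact/ltnW.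
  apply: (le_trans (sq4 _ _ _ _)).
  by rewrite !exprMn [rem1 (P n) ^+ 2 * _]mulrC [rem0 (P n) ^+ 2 * _]mulrC.
rewrite -mulr_sumr ler_pM2l// !big_split/= -!mulr_suml.
by rewrite !lerD// ler_wpM2r ?sqr_ge0 ?rem0_l2 ?rem1_l2 ?Lquo_l2 ?LXquo_l2.
Qed.

(** [quo] is a Hilbert-Schmidt operator, because its matrix coefficients are
    combinations of products of square summable sequences. *)
Lemma quo_HilbertSchmidt n :
  \sum_(k < n) L (quo (P k) ^+ 2) <= 16 * C * quoC.
Proof.
apply: le_trans; first by apply: ler_sum => k _; exact: L_sqr_quo_orthonormal.
rewrite -mulr_sumr !big_split/= -!mulr_sumr.
have C0 := rem_bound_ge0.
have Q0 : 0 <= quoC by apply: le_trans (Lquo_l2 1); apply: sumr_ge0 => k _; exact: sqr_ge0.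
have := ler_wpM2l C0 (LXquo_l2 n); have := ler_wpM2l C0 (Lquo_l2 n).
have := ler_wpM2l Q0 (rem1_l2 n); have := ler_wpM2l Q0 (rem0_l2 n).
set a := C * \sum_(k < n) L (quo _) ^+ 2.
set b := C * _; set c := quoC * _; set d := quoC * _; lra.
Qed.

Lemma L_combination_sqr_le n (c : nat -> R) (q : {poly R}) :
  (size q <= n)%N ->
  (\sum_(k < n) L (P k * q) * c k) ^+ 2 <= (\sum_(k < n) c k ^+ 2) * L (q ^+ 2).
Proof.
move=> sq; pose s : {poly R} := \sum_(k < n) c k *: P k.
have -> : \sum_(k < n) L (P k * q) * c k = L (s * q).
  rewrite mulr_suml linear_sum/=; apply: eq_bigr => k _.
  by rewrite -scalerAl LZ mulrC.
have -> : \sum_(k < n) c k ^+ 2 = L (s ^+ 2).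
  rewrite (L_parseval PP (size_orthonormal_sum PP n c)); apply: eq_bigr => k _.
  by rewrite (L_orthonormal_mulsum PP) ltn_ord.
exact: L_CauchySchwarz.
Qed.

(** The squared norm of the evaluation at [x] on polynomials of size at most
    [n], that is, the inverse of the Christoffel function. *)
Definition Kdiag n x := \sum_(k < n) (P k).[x] ^+ 2.

Lemma Kdiag_ge0 n x : 0 <= Kdiag n x.
Proof. by apply: sumr_ge0 => k _; exact: sqr_ge0. Qed.

Lemma KdiagS n x : Kdiag n.+1 x = Kdiag n x + (P n).[x] ^+ 2.
Proof. by rewrite /Kdiag big_ord_recr. Qed.

Lemma horner_orthonormal n w : (P n).[w] =
  (rem1 (P n) * w + rem0 (P n)) + (w ^+ 2 + 1) * (quo (P n)).[w].
Proof.
rewrite {1}(quadr_divE (P n)) /quadr !hornerE/= ; ring.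
Qed.

Let szq n : (size (quo (P n)) <= n)%N.
Proof. by rewrite (leq_trans (size_quo _))// (size_orthonormal PP). Qed.

Lemma horner_quo_sqr_le n w :
  (quo (P n)).[w] ^+ 2 <= Kdiag n w * L (quo (P n) ^+ 2).
Proof.
rewrite (horner_orthonormal_expansion PP w (szq n)).
exact: (L_combination_sqr_le (fun k => (P k).[w])).
Qed.

Lemma horner_quo_diff_sqr_le n w w' :
  ((quo (P n)).[w] - (quo (P n)).[w']) ^+ 2 <=
  (\sum_(k < n) ((P k).[w] - (P k).[w']) ^+ 2) * L (quo (P n) ^+ 2).
Proof.
rewrite !(horner_orthonormal_expansion PP _ (szq n)) -sumrB.
under eq_bigr do rewrite -mulrBr.
exact: (L_combination_sqr_le (fun k => (P k).[w] - (P k).[w'])).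
Qed.

Let sqrD_le (a b : R) : (a + b) ^+ 2 <= 2 * a ^+ 2 + 2 * b ^+ 2.
Proof. by have := sqr_ge0 (a - b); rewrite !expr2; lra. Qed.

Definition HS : R := 16 * C * quoC.

Definition Kbound (r : R) : R :=
  2 * (2 * (r ^+ 2 + 1) * C) * expR (2 * (r ^+ 2 + 1) ^+ 2 * HS).

Lemma sqr_le_bound (w r : R) : `|w| <= r -> w ^+ 2 <= r ^+ 2.
Proof.
move=> wr; rewrite -[w ^+ 2]real_normK ?num_real// lerXn2r ?nnegrE//.
exact: le_trans wr.
Qed.

(** In the decomposition [horner_orthonormal] the remainders are square
    summable, and [quo (P n)] is a combination of the [P k] with [k < n] whose coefficients
    are those of a Hilbert-Schmidt operator; so Gronwall applies to the values
    [(P n).[w]]. *)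
Lemma Kdiag_bounded (r : R) n (w : R) : `|w| <= r -> Kdiag n w <= Kbound r.
Proof.
move=> wr; have w2 := sqr_le_bound wr.
pose B k := L (quo (P k) ^+ 2).
have M0 : 0 <= (w ^+ 2 + 1) ^+ 2 by exact: sqr_ge0.
have step k : (P k).[w] ^+ 2 <= 2 * (rem1 (P k) * w + rem0 (P k)) ^+ 2
    + 2 * (w ^+ 2 + 1) ^+ 2 * B k * \sum_(j < k) (P j).[w] ^+ 2.
  rewrite {1}horner_orthonormal (le_trans (sqrD_le _ _))// lerD2l exprMn.
  have := ler_wpM2l M0 (horner_quo_sqr_le k w); rewrite -/(B k) /Kdiag.
  by set S := \sum_(_ < k) _; lra.
apply: (le_trans (gronwall_squares (v := fun k => (P k).[w]) (B := B) M0
  (fun k => L_sqr_ge0 _) step n)).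
rewrite /Kbound ler_pM ?expR_ge0//.
- by rewrite mulr_ge0// sumr_ge0// => k _; exact: sqr_ge0.
- rewrite ler_pM2l//.
  apply: (@le_trans _ _ (\sum_(k < n) (2 * w ^+ 2 * rem1 (P k) ^+ 2 + 2 * rem0 (P k) ^+ 2))).
    apply: ler_sum => k _; apply: (le_trans (sqrD_le _ _)).
    by rewrite exprMn [rem1 _ ^+ 2 * _]mulrC mulrA.
  rewrite big_split/= -!mulr_sumr.
  have C0 := rem_bound_ge0.
  have h1 : w ^+ 2 * \sum_(k < n) rem1 (P k) ^+ 2 <= r ^+ 2 * C.
    by rewrite ler_pM ?sqr_ge0 ?rem1_l2// sumr_ge0// => k _; exact: sqr_ge0.
  by have := rem0_l2 n; move: h1; rewrite -mulrA; lra.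
- rewrite ler_expR ler_pM ?quo_HilbertSchmidt//.
  + by rewrite mulr_ge0.
  + by rewrite sumr_ge0// => k _; exact: L_sqr_ge0.
  + rewrite ler_pM2l// lerXn2r ?nnegrE ?addr_ge0 ?sqr_ge0//.
    by rewrite lerD2r.
Qed.

Definition Lipbound (r : R) : R :=
  2 * (2 * C + 8 * r ^+ 2 * (HS * Kbound r)) * expR (2 * (r ^+ 2 + 1) ^+ 2 * HS).

(** The same recursion, for the differences of the values at two points. *)
Lemma kernel_Lipschitz (r : R) n (w w' : R) : `|w| <= r -> `|w'| <= r ->
  \sum_(k < n) ((P k).[w] - (P k).[w']) ^+ 2 <= Lipbound r * (w - w') ^+ 2.
Proof.
move=> wr w'r; have w2 := sqr_le_bound wr; have w'2 := sqr_le_bound w'r.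
pose B k := L (quo (P k) ^+ 2).
pose v k := (P k).[w] - (P k).[w'].
pose u k := rem1 (P k) * (w - w') + (w ^+ 2 - w' ^+ 2) * (quo (P k)).[w].
have M0 : 0 <= (w' ^+ 2 + 1) ^+ 2 by exact: sqr_ge0.
have step k : v k ^+ 2 <= 2 * u k ^+ 2
    + 2 * (w' ^+ 2 + 1) ^+ 2 * B k * \sum_(j < k) v j ^+ 2.
  have -> : v k = u k + (w' ^+ 2 + 1) * ((quo (P k)).[w] - (quo (P k)).[w']).
    rewrite /v /u 2!horner_orthonormal; ring.
  rewrite (le_trans (sqrD_le _ _))// lerD2l exprMn.
  have := ler_wpM2l M0 (horner_quo_diff_sqr_le k w w'); rewrite -/(B k).
  by set S := \sum_(_ < k) _; set T := (_ - _) ^+ 2; lra.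
apply: (le_trans (gronwall_squares (v := v) (B := B) M0 (fun k => L_sqr_ge0 _) step n)).
have C0 := rem_bound_ge0.
have KB0 : 0 <= Kbound r by apply: le_trans (Kdiag_bounded 0 wr); exact: Kdiag_ge0.
have su : \sum_(k < n) u k ^+ 2 <=
    (2 * C + 8 * r ^+ 2 * (HS * Kbound r)) * (w - w') ^+ 2.
  apply: (@le_trans _ _ (\sum_(k < n) (w - w') ^+ 2 *
     (2 * rem1 (P k) ^+ 2 + 8 * r ^+ 2 * Kbound r * B k))).
    apply: ler_sum => k _.
    have -> : u k = (w - w') * (rem1 (P k) + (w + w') * (quo (P k)).[w]).
      by rewrite /u; ring.
    rewrite exprMn ler_wpM2l ?sqr_ge0// (le_trans (sqrD_le _ _))// lerD2l.
    rewrite exprMn.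
    have h1 : (w + w') ^+ 2 <= 4 * r ^+ 2 by have := sqrD_le w w'; lra.
    have h2 : (quo (P k)).[w] ^+ 2 <= Kbound r * B k.
      apply: (le_trans (horner_quo_sqr_le _ _)).
      by rewrite ler_wpM2r// Kdiag_bounded.
    have := ler_pM (sqr_ge0 _) (sqr_ge0 _) h1 h2; lra.
  rewrite -mulr_sumr mulrC ler_wpM2r ?sqr_ge0// big_split/= -!mulr_sumr.
  rewrite lerD//; first by rewrite ler_pM2l// rem1_l2.
  have K0 : 0 <= 8 * r ^+ 2 * Kbound r by do 2 (apply: mulr_ge0 => //); exact: sqr_ge0.
  have := ler_wpM2l K0 (quo_HilbertSchmidt n); rewrite -/HS /B.
  by set S := \sum_(_ < n) _; lra.
rewrite /Lipbound [leRHS]mulrAC ler_pM ?expR_ge0//.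
- by rewrite mulr_ge0// sumr_ge0// => k _; exact: sqr_ge0.
- by rewrite -[leRHS]mulrA ler_pM2l.
- rewrite ler_expR ler_pM ?quo_HilbertSchmidt//.
  + by rewrite mulr_ge0.
  + by rewrite sumr_ge0// => k _; exact: L_sqr_ge0.
  + rewrite ler_pM2l// lerXn2r ?nnegrE ?addr_ge0 ?sqr_ge0//.
    by rewrite lerD2r.
Qed.

End LocalBounds.

(** * Gauss quadrature *)

Section RealFactors.
Variable R : rcfType.

(** The real polynomial with the complex roots [a + i b] and [a - i b]. *)
Definition quadratic (a b : R) : {poly R} := ('X - a%:P) ^+ 2 + (b ^+ 2)%:P.

Lemma size_quadratic a b : size (quadratic a b) = 3%N.
Proof.
rewrite /quadratic size_polyDl ?size_exp_XsubC//.
by rewrite size_polyC; case: (_ != 0).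
Qed.

(** [p] has a complex root [a + i b]. If [b] is not zero, then the remainder of
    [p] modulo [quadratic a b] is a real polynomial of degree at most one with
    a nonreal root, hence zero. *)
Lemma real_root_or_quadratic_factor (p : {poly R}) : (1 < size p)%N ->
  (exists x, root p x) \/ (exists a b, quadratic a b %| p).
Proof.
move=> sp.
have /closed_rootP[[a b] rz] : size (map_poly (real_complex R) p) != 1%N.
  by rewrite size_map_poly gtn_eqF.
have [b0|b0] := eqVneq b 0.
  left; exists a; rewrite -(fmorph_root (real_complex R)).
  by move: rz; rewrite b0.
right; exists a, b; rewrite /dvdp; set r := p %% _.
have sr : (size r <= 2)%N.
  by rewrite -ltnS -(size_quadratic a b) ltn_modp -size_poly_eq0 size_quadratic.
have Er : r = r`_1 *: 'X + (r`_0)%:P.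
  apply/polyP => i; rewrite coefD coefZ coefX coefC.
  case: i => [|[|i]]/=; rewrite ?mulr0 ?mulr1 ?add0r ?addr0//.
  by rewrite nth_default// (leq_trans sr).
move: rz; rewrite /root {1}(divp_eq p (quadratic a b)) -/r Er.
rewrite rmorphD rmorphM/= hornerD hornerM.
have -> : (map_poly (real_complex R) (quadratic a b)).[(a +i* b)%C] = 0.
  rewrite /quadratic rmorphD rmorphXn/= rmorphB/= map_polyX !map_polyC/=.
  rewrite !hornerE/= expr2; simpc; apply/eqP; rewrite eq_complex/=.
  by rewrite expr2 addNr !eqxx.
rewrite mulr0 add0r rmorphD/= map_polyZ/= map_polyX map_polyC/= !hornerE/=.
simpc; rewrite eq_complex/= => /andP[/eqP r0 /eqP].
move/eqP; rewrite mulf_eq0 (negbTE b0) orbF => /eqP r1.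
by move: r0; rewrite r1 mul0r add0r => ->; rewrite scale0r addr0.
Qed.

End RealFactors.

Section GaussQuadrature.
Variables (R : realType) (L : {scalar {poly R}}).
Hypothesis L_pos : forall p : {poly R}, p != 0 -> 0 < L (p ^+ 2).
Variable P : nat -> {poly R}.
Hypothesis PP : orthonormal_polys L P.

Let LD (p q : {poly R}) : L (p + q) = L p + L q. Proof. exact: linearD. Qed.
Let LZ c (p : {poly R}) : L (c *: p) = c * L p. Proof. exact: linearZ. Qed.

(** Writing [P n = h * quadratic a b] would make [L (P n * h)] a sum of two
    squares, although [P n] is orthogonal to [h]. This excludes nonreal roots
    ([b != 0]) and multiple ones ([b = 0]) at once. *)
Lemma orthonormal_quadratic_free n a b : ~~ (quadratic a b %| P n).
Proof.
apply/negP => /dvdpP[h hE].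
have Pn0 : P n != 0 by rewrite -size_poly_eq0 (size_orthonormal PP).
have h0 : h != 0 by apply: contra_neq Pn0 => h0; rewrite hE h0 mul0r.
have q0 : quadratic a b != 0 by rewrite -size_poly_eq0 size_quadratic.
have sh : (size h <= n)%N.
  have := size_orthonormal PP n; rewrite hE size_mul// size_quadratic addn3/=.
  by case=> <-; exact: leqnSn.
have := L_orthonormal_low PP sh.
have -> : P n * h = (('X - a%:P) * h) ^+ 2 + b ^+ 2 *: h ^+ 2.
  by rewrite hE /quadratic -mul_polyC; ring.
rewrite LD LZ => h1.
have := L_pos (mulf_neq0 (negbT (polyXsubC_eq0 a)) h0).
have := mulr_ge0 (sqr_ge0 b) (ltW (L_pos h0)); lra.
Qed.

Lemma orthonormal_real_roots n : exists s : seq R,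
  [/\ uniq s, size s = n & forall x, x \in s -> root (P n) x].
Proof.
suff H k : (k <= n)%N -> exists (s : seq R) (g : {poly R}),
    [/\ uniq s, size s = k & P n = g * \prod_(x <- s) ('X - x%:P)].
  have [s [g [us ss E]]] := H n (leqnn n); exists s; split => // x xs.
  by rewrite E rootM root_prod_XsubC xs orbT.
elim: k => [_|k IH kn].
  by exists [::], (P n); rewrite big_nil mulr1.
have [s [g [us ss E]]] := IH (ltnW kn).
have Pn0 : P n != 0 by rewrite -size_poly_eq0 (size_orthonormal PP).
have g0 : g != 0 by apply: contra_neq Pn0 => h0; rewrite E h0 mul0r.
have sg : (1 < size g)%N.
  have := size_orthonormal PP n; rewrite E size_mul//; last first.
    by rewrite -size_poly_eq0 size_prod_XsubC.
  rewrite size_prod_XsubC ss addnS/= => h.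
  by rewrite -(ltn_add2r k) h add1n ltnS.
have [[x]|[a [b ab]]] := real_root_or_quadratic_factor sg; last first.
  have := orthonormal_quadratic_free n a b.
  by rewrite E (dvdp_mulr _ ab).
move=> /factor_theorem[h hE].
exists (x :: s), h; split => /=; last 2 first.
- by rewrite ss.
- by rewrite big_cons mulrA -hE.
rewrite us andbT; apply/negP => xs.
have := orthonormal_quadratic_free n x 0; apply/negP; rewrite negbK /quadratic.
rewrite expr0n addr0 E hE expr2 (perm_big _ (perm_to_rem xs))/= big_cons.
by apply/dvdpP; exists (h * \prod_(j <- rem x s) ('X - j%:P)); ring.
Qed.

Definition Kpoly n x : {poly R} := \sum_(k < n) (P k).[x] *: P k.

Lemma size_Kpoly n x : (size (Kpoly n x) <= n)%N.
Proof. exact: (size_orthonormal_sum PP n (fun k => (P k).[x])). Qed.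

Lemma horner_Kpoly n x y : (Kpoly n x).[y] = \sum_(k < n) (P k).[x] * (P k).[y].
Proof. by rewrite horner_sum; apply: eq_bigr => k _; rewrite hornerZ. Qed.

Lemma horner_Kpoly_diag n x : (Kpoly n x).[x] = Kdiag P n x.
Proof. by rewrite horner_Kpoly; apply: eq_bigr => k _; rewrite expr2. Qed.

Lemma Kpoly_reproducing n x (q : {poly R}) : (size q <= n)%N ->
  L (Kpoly n x * q) = q.[x].
Proof.
move=> sq; rewrite (horner_orthonormal_expansion PP x sq) mulr_suml linear_sum/=.
by apply: eq_bigr => k _; rewrite -scalerAl LZ mulrC.
Qed.

Lemma L_sqr_Kpoly n x : L (Kpoly n x ^+ 2) = Kdiag P n x.
Proof. by rewrite expr2 Kpoly_reproducing ?size_Kpoly// horner_Kpoly_diag. Qed.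

Lemma sqr_horner_le n x (q : {poly R}) : (size q <= n)%N ->
  q.[x] ^+ 2 <= Kdiag P n x * L (q ^+ 2).
Proof.
move=> sq; rewrite -(Kpoly_reproducing x sq) -L_sqr_Kpoly.
exact: L_CauchySchwarz.
Qed.

Lemma L1_gt0 : 0 < L 1.
Proof. by have := L_pos (oner_neq0 {poly R}); rewrite expr1n. Qed.

Lemma Kdiag1 x : Kdiag P 1 x = (L 1)^-1.
Proof.
have L1 := L1_gt0.
rewrite /Kdiag big_ord1/=.
have [c E] : exists c, P 0 = c%:P.
  by exists (P 0)`_0; apply: size1_polyC; rewrite (size_orthonormal PP).
rewrite E hornerC.
have := L_orthonormal_sqr PP 0; rewrite E -polyC_exp -alg_polyC LZ => h.
by apply: (mulIf (lt0r_neq0 L1)); rewrite h mulVf// gt_eqF.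
Qed.

Lemma Kdiag_mono n m x : (n <= m)%N -> Kdiag P n x <= Kdiag P m x.
Proof.
move=> /subnKC <-; elim: (m - n)%N => [|k IH]; first by rewrite addn0.
by rewrite addnS KdiagS (le_trans IH)// lerDl sqr_ge0.
Qed.

Lemma Kdiag_ge n x : (0 < n)%N -> (L 1)^-1 <= Kdiag P n x.
Proof. by move=> n0; rewrite -(Kdiag1 x) Kdiag_mono. Qed.

Lemma Kdiag_gt0 n x : (0 < n)%N -> 0 < Kdiag P n x.
Proof. by move=> n0; apply: (lt_le_trans _ (Kdiag_ge x n0)); rewrite invr_gt0 L1_gt0. Qed.

(** The quotient [P n / (X - x)] is proportional to the reproducing kernel at
    [x]; so the kernel at one root of [P n] vanishes at all the others. *)
Lemma Kpoly_roots n x y : root (P n) x -> root (P n) y -> x != y ->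
  (Kpoly n x).[y] = 0.
Proof.
move=> /factor_theorem[g gE] ry xy.
have Pn0 : P n != 0 by rewrite -size_poly_eq0 (size_orthonormal PP).
have g0 : g != 0 by apply: contra_neq Pn0 => h0; rewrite gE h0 mul0r.
have sg : size g = n.
  have := size_orthonormal PP n; rewrite gE size_mul ?polyXsubC_eq0// size_XsubC addn2/=.
  by case.
have Lg (q : {poly R}) : (size q <= n)%N -> L (g * q) = L g * q.[x].
  move=> sq; have : root (q - q.[x]%:P) x by rewrite /root !hornerE subrr.
  move=> /factor_theorem[h hE].
  have -> : g * q = P n * h + q.[x] *: g.
    by rewrite gE -mul_polyC -[q in g * q](subrK q.[x]%:P) hE; ring.
  rewrite LD LZ (L_orthonormal_low PP) ?add0r 1?mulrC//.
  have [->|h0] := eqVneq h 0; first by rewrite size_poly0.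
  have : (size (h * ('X - x%:P))%R <= n)%N.
    rewrite -hE (leq_trans (size_polyD _ _))// geq_max sq size_polyN size_polyC.
    case: (_ != 0) => //=; rewrite (leq_trans _ sq)// lt0n size_poly_eq0.
    by apply: contra_neq h0 => q0; move: hE; rewrite q0 horner0 subrr => /esym/eqP;
      rewrite mulf_eq0 polyXsubC_eq0 orbF => /eqP.
  by rewrite size_mul ?polyXsubC_eq0// size_XsubC addn2/=; exact/leq_trans/leqnSn.
have gK : g = L g *: Kpoly n x.
  rewrite {1}(orthonormal_expansion PP (eq_leq sg)) scaler_sumr; apply: eq_bigr => k _.
  by rewrite mulrC Lg ?(size_orthonormal PP)// scalerA.
have Lg0 : L g != 0 by apply: contra_neq g0 => h; rewrite gK h scale0r.
have gy : g.[y] = 0.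
  move: ry; rewrite gE rootM root_XsubC eq_sym (negbTE xy) orbF.
  by rewrite /root => /eqP.
by move: gy; rewrite gK hornerZ => /eqP; rewrite mulf_eq0 (negbTE Lg0) => /eqP.
Qed.

(** The kernels at the [n] roots of [P n] are orthogonal, and the polynomial [q]
    equals its expansion [f] along them because both have size at most [n] and
    agree at the [n] roots. *)
Lemma gauss_parseval n (s : seq R) (q : {poly R}) :
  uniq s -> size s = n -> (forall x, x \in s -> root (P n) x) ->
  (size q <= n)%N ->
  L (q ^+ 2) = \sum_(x <- s) q.[x] ^+ 2 / Kdiag P n x.
Proof.
move=> us ss rs sq.
have [n0|n0] := posnP n.
  move: ss sq; rewrite n0 => /size0nil -> /size_poly_leq0P ->.
  by rewrite big_nil expr0n/= linear0.
have Kn0 x : Kdiag P n x != 0 by rewrite gt_eqF// Kdiag_gt0.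
pose f : {poly R} := \sum_(x <- s) (q.[x] / Kdiag P n x) *: Kpoly n x.
have sf : (size f <= n)%N.
  rewrite /f; elim/big_rec : _ => [|x p _ sp]; first by rewrite size_poly0.
  rewrite (leq_trans (size_polyD _ _))// geq_max sp andbT.
  by rewrite (leq_trans (size_scale_leq _ _))// size_Kpoly.
have qf : q = f.
  apply/eqP; rewrite -subr_eq0; apply/eqP.
  apply: (@roots_geq_poly_eq0 _ _ s) => //; last first.
    by rewrite (leq_trans (size_polyD _ _))// geq_max size_polyN ss sq.
  apply/allP => y ys; rewrite /root hornerD hornerN /f horner_sum.
  rewrite (bigD1_seq y)//= big1_seq ?addr0.
    by rewrite hornerZ horner_Kpoly_diag divfK// subrr.
  by move=> x /andP[xy xs]; rewrite hornerZ Kpoly_roots ?mulr0// rs.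
rewrite expr2 {1}qf mulr_suml linear_sum/=.
apply: eq_bigr => x _; rewrite -scalerAl LZ Kpoly_reproducing// mulrAC.
by rewrite expr2.
Qed.

End GaussQuadrature.

(** * Limits of quadratures along an ultrafilter *)

Section SeqSums.
Variables (R : realFieldType) (T : eqType).

Lemma ler_sum_subseq (F s : seq T) (f : T -> R) : uniq F -> uniq s ->
  {subset F <= s} -> (forall x, x \in s -> 0 <= f x) ->
  \sum_(x <- F) f x <= \sum_(x <- s) f x.
Proof.
move=> uF us Fs f0; rewrite [leRHS](bigID (mem F))/=.
have -> : \sum_(x <- s | x \in F) f x = \sum_(x <- F) f x.
  rewrite -big_filter; apply: perm_big; apply: uniq_perm => //.
    exact: filter_uniq.
  by move=> x; rewrite mem_filter; case: (boolP (x \in F)) => // /Fs ->.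
rewrite lerDl big_seq_cond; apply: sumr_ge0 => x /andP[xs _]; exact: f0.
Qed.

End SeqSums.

Section UltrafilterLimits.
Variable R : realType.

Lemma cvg_sum_seq (T : Type) (S : eqType) (U : set_system T) (UF : Filter U) (l : seq S)
    (f : S -> T -> R) (a : S -> R) :
  (forall x, x \in l -> f x n @[n --> U] --> a x) ->
  (\sum_(x <- l) f x n) @[n --> U] --> \sum_(x <- l) a x.
Proof.
elim: l => [_|x l IH h].
  rewrite big_nil; under eq_fun do rewrite big_nil; exact: cvg_cst.
rewrite big_cons; under eq_fun do rewrite big_cons.
by apply: cvgD; [apply: h; exact: mem_head|apply: IH => y yl; apply: h; rewrite inE yl orbT].
Qed.

Lemma near_all_seq (T : Type) (S : eqType) (U : set_system T) (UF : Filter U)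
    (l : seq S) (Q : S -> T -> Prop) :
  (forall x, x \in l -> \forall n \near U, Q x n) ->
  \forall n \near U, forall x, x \in l -> Q x n.
Proof.
elim: l => [_|x l IH h]; first exact: nearW.
have h1 := h x (mem_head _ _).
have h2 : \forall n \near U, forall x, x \in l -> Q x n.
  by apply: IH => y yl; apply: h; rewrite inE yl orbT.
by apply: filterS2 h1 h2 => n Qx Ql y; rewrite inE => /predU1P[->//|]; exact: Ql.
Qed.

Lemma ultra_fmap (T S : Type) (U : set_system T) (UF : UltraFilter U)
  (f : T -> S) : UltraFilter (f @ U).
Proof.
split; first exact: fmap_proper_filter.
move=> G GF fUG; rewrite predeqE => A; split; last exact: fUG.
move=> GA; have [//|UnA] := in_ultra_setVsetC (f @^-1` A) UF.
have : G (A `&` ~` A) by apply: filterI => //; apply: fUG.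
by rewrite setICr => /(@filter_not_empty _ G).
Qed.

Lemma ultra_bounded_cvg (T : Type) (U : set_system T) (UF : UltraFilter U)
    (y : T -> R) (r : R) :
  (\forall n \near U, `|y n| <= r) -> exists x : R, y n @[n --> U] --> x.
Proof.
move=> yr.
have cpt : compact `[- r, r]%classic by exact: segment_compact.
have := cpt; rewrite compact_ultra => /(_ _ (ultra_fmap UF y)).
case=> [|x [_ yx]]; last by exists x.
rewrite /= nbhs_simpl/=; apply: filterS yr => n/=.
by rewrite ler_norml in_itv.
Qed.

Lemma ultra_const_nat (T : Type) (U : set_system T) (UF : UltraFilter U)
    (f : T -> nat) m :
  (\forall n \near U, (f n <= m)%N) -> exists j, \forall n \near U, f n = j.
Proof.
elim: m => [h|m IH h].
  by exists 0%N; apply: filterS h => n; rewrite leqn0 => /eqP.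
have [h1|h1] := in_ultra_setVsetC [set n | (f n <= m)%N] UF; first exact: IH.
have {}h1 : \forall n \near U, ~ (f n <= m)%N by exact: h1.
exists m.+1; apply: filterS2 h h1 => n h2 /negP.
by rewrite -ltnNge => h3; apply/eqP; rewrite eqn_leq h2.
Qed.

End UltrafilterLimits.

Section LimitOfQuadratures.
Variables (R : realType) (L : {scalar {poly R}}).
Hypothesis L_pos : forall p : {poly R}, p != 0 -> 0 < L (p ^+ 2).
Variable P : nat -> {poly R}.
Hypothesis PP : orthonormal_polys L P.
Variable M : R -> R.
Hypothesis K_le : forall (r : R) n (w : R), `|w| <= r -> Kdiag P n w <= M r.
Hypothesis K_lip : forall (r : R) n (w w' : R), `|w| <= r -> `|w'| <= r ->
  \sum_(k < n) ((P k).[w] - (P k).[w']) ^+ 2 <= M r * (w - w') ^+ 2.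

Let L1_pos := L1_gt0 L_pos.

Definition Kdiag_lim (x : R) := limn (fun n => Kdiag P n x).

Lemma Kdiag_cvg x : Kdiag P n x @[n --> \oo] --> Kdiag_lim x.
Proof.
apply: nondecreasing_is_cvgn; first by move=> m n /(Kdiag_mono P x).
by exists (M `|x|) => _ [n _ <-]; exact: K_le.
Qed.

Lemma Kdiag_le_lim n x : Kdiag P n x <= Kdiag_lim x.
Proof.
apply: (@nondecreasing_cvgn_le _ (fun n => Kdiag P n x)); last exact/cvgP/Kdiag_cvg.
by move=> i j /(Kdiag_mono P x).
Qed.

Lemma Kdiag_lim_gt0 x : 0 < Kdiag_lim x.
Proof. exact: (lt_le_trans (Kdiag_gt0 L_pos PP x (ltn0Sn 0)) (Kdiag_le_lim _ _)). Qed.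

Lemma M_gt0 (r : R) : 0 <= r -> 0 < M r.
Proof.
move=> r0; apply: (lt_le_trans (Kdiag_gt0 L_pos PP 0 (ltn0Sn 0))).
by apply: K_le; rewrite normr0.
Qed.

(** Termwise [|a^2 - b^2|] is at most half of
    [(a - b)^2 / d + d (a + b)^2]; with [d] the distance of the two points both
    sums are of order [d]. *)
Lemma Kdiag_diff_le (r : R) n (w w' : R) : `|w| <= r -> `|w'| <= r ->
  `|Kdiag P n w - Kdiag P n w'| <= 3 * M r * `|w - w'|.
Proof.
move=> wr w'r; have [->|ww'] := eqVneq w w'.
  by rewrite !subrr normr0 mulr0.
set d := `|w - w'|; have d0 : 0 < d by rewrite normr_gt0 subr_eq0.
have key (a b : R) : `|a ^+ 2 - b ^+ 2| <=
    2^-1 * ((a - b) ^+ 2 / d + d * (2 * a ^+ 2 + 2 * b ^+ 2)).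
  have h1 : (a + b) ^+ 2 <= 2 * a ^+ 2 + 2 * b ^+ 2.
    by have := sqr_ge0 (a - b); rewrite !expr2; lra.
  have h2 : `|a ^+ 2 - b ^+ 2| = `|a - b| * `|a + b| by rewrite -normrM; congr `|_|; ring.
  apply: (@le_trans _ _ (2^-1 * ((a - b) ^+ 2 / d + d * (a + b) ^+ 2))); last first.
    by rewrite ler_pM2l ?invr_gt0// lerD2l ler_pM2l.
  rewrite h2 -(ler_pM2r d0) -[(a - b) ^+ 2]real_normK ?num_real//.
  rewrite -[(a + b) ^+ 2]real_normK ?num_real//.
  have -> : 2^-1 * (`|a - b| ^+ 2 / d + d * `|a + b| ^+ 2) * d =
     2^-1 * (`|a - b| ^+ 2 + (d * `|a + b|) ^+ 2) by field; rewrite gt_eqF.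
  by have := sqr_ge0 (`|a - b| - d * `|a + b|); rewrite !expr2; lra.
rewrite /Kdiag -sumrB (le_trans (ler_norm_sum _ _ _))//.
apply: (@le_trans _ _ (\sum_(k < n) 2^-1 * (((P k).[w] - (P k).[w']) ^+ 2 / d +
   d * (2 * (P k).[w] ^+ 2 + 2 * (P k).[w'] ^+ 2)))).
  by apply: ler_sum => k _; exact: key.
rewrite -mulr_sumr big_split/= -mulr_suml -mulr_sumr big_split/= -!mulr_sumr.
rewrite -/(Kdiag P n w) -/(Kdiag P n w').
have h1 : (\sum_(i < n) ((P i).[w] - (P i).[w']) ^+ 2) / d <= M r * d.
  rewrite ler_pdivrMr// -mulrA -expr2 real_normK ?num_real//.
  exact: K_lip.
have h2 := ler_wpM2l (ltW d0) (K_le n wr).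
have h3 := ler_wpM2l (ltW d0) (K_le n w'r).
have h4 := mulr_ge0 (ltW d0) (Kdiag_ge0 P n w).
lra.
Qed.

Variable U : set_system nat.
Hypothesis UF : UltraFilter U.
Hypothesis U_oo : \oo `<=` U.
Variable s : nat -> seq R.
Hypothesis s_nodes : forall n,
  [/\ uniq (s n), size (s n) = n & forall x, x \in s n -> root (P n) x].

(** The limits of nodes of the quadratures will carry the N-extremal measure. *)
Definition limit_node (x : R) :=
  exists2 y : nat -> R, (\forall n \near U, y n \in s n) & y n @[n --> U] --> x.

Lemma U_ge m : \forall n \near U, (m <= n)%N.
Proof. by apply: U_oo; exists m. Qed.

Lemma Kdiag_cvg_nodes (y : nat -> R) (x : R) : y n @[n --> U] --> x ->
  Kdiag P n (y n) @[n --> U] --> Kdiag_lim x.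
Proof.
move=> yx.
have Kx : Kdiag P n x @[n --> U] --> Kdiag_lim x.
  by apply: cvg_trans (@Kdiag_cvg x); exact: (cvg_app _ U_oo).
have yx0 : 3 * M (`|x| + 1) * `|y n - x| @[n --> U] --> 0.
  have <- : 3 * M (`|x| + 1) * `|x - x| = 0 by rewrite subrr normr0 mulr0.
  apply: cvgM; first exact: cvg_cst.
  by apply: cvg_norm; apply: cvgB => //; exact: cvg_cst.
rewrite -[Kdiag_lim x]add0r.
under eq_fun => n do rewrite -[Kdiag P n (y n)](subrK (Kdiag P n x)).
apply: cvgD => //; apply/norm_cvg0P; apply: (squeeze_cvgr _ (cvg_cst 0) yx0).
near=> n; rewrite normr_ge0/= Kdiag_diff_le//; last by rewrite lerDl.
rewrite -[y n](subrK x) (le_trans (ler_normD _ _))// addrC lerD2l.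
near: n; move/cvgrPdist_le : yx => /(_ _ ltr01); apply: filterS => n.
by rewrite distrC.
Unshelve. all: by end_near. Qed.

Lemma mass_cvg_nodes (q : {poly R}) (y : nat -> R) (x : R) : y n @[n --> U] --> x ->
  q.[y n] ^+ 2 / Kdiag P n (y n) @[n --> U] --> q.[x] ^+ 2 / Kdiag_lim x.
Proof.
move=> yx; apply: cvgM.
  have qx : q.[y n] @[n --> U] --> q.[x].
    exact: (cvg_comp _ _ yx (@continuous_horner _ q x)).
  by under eq_fun do rewrite expr2; rewrite expr2; exact: cvgM.
by apply: cvgV; [rewrite gt_eqF// Kdiag_lim_gt0|exact: Kdiag_cvg_nodes].
Qed.

(** Distinct limit nodes are limits of nodes that are eventually distinct, so
    the left-hand side is a limit of partial sums of Gauss quadratures of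
    [q ^ 2]. *)
Lemma limit_nodes_bessel (F : seq R) (q : {poly R}) : uniq F ->
  (forall x, x \in F -> limit_node x) ->
  \sum_(x <- F) q.[x] ^+ 2 / Kdiag_lim x <= L (q ^+ 2).
Proof.
move=> uF Fl.
have /choice[Y HY] : forall x : R, exists y : nat -> R, limit_node x ->
    (\forall n \near U, y n \in s n) /\ y n @[n --> U] --> x.
  move=> x; have [[y y1 y2]|nx] := pselect (limit_node x); first by exists y.
  by exists (fun=> 0).
have cv : \sum_(x <- F) q.[Y x n] ^+ 2 / Kdiag P n (Y x n) @[n --> U] -->
    \sum_(x <- F) q.[x] ^+ 2 / Kdiag_lim x.
  apply: cvg_sum_seq => x xF; apply: mass_cvg_nodes.
  by have [] := HY x (Fl x xF).
apply: (cvgr_to_le cv).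
have near1 : \forall n \near U, forall x, x \in F -> Y x n \in s n.
  by apply: near_all_seq => x /Fl /HY[].
have near2 : \forall n \near U, forall x, x \in F ->
    forall z, z \in F -> x != z -> Y x n != Y z n.
  apply: near_all_seq => x xF; apply: near_all_seq => z zF.
  have [->|xz] := eqVneq x z; first exact: nearW.
  have [_ Yx] := HY _ (Fl _ xF); have [_ Yz] := HY _ (Fl _ zF).
  have d0 : 0 < `|x - z| by rewrite normr_gt0 subr_eq0.
  have cd : `|Y x n - Y z n| @[n --> U] --> `|x - z|.
    by apply: cvg_norm; exact: cvgB.
  have h : \forall n \near U, 0 < `|Y x n - Y z n| := cvgr_gt _ cd _ d0.
  by near=> n => _; rewrite -subr_eq0 -normr_gt0; near: n; exact: h.
have near3 := U_ge (size q); have near4 := U_ge 1.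
near=> n.
have [us ss rs] := s_nodes n.
have Kn x : 0 < Kdiag P n x by apply: (Kdiag_gt0 L_pos PP); near: n.
rewrite (gauss_parseval L_pos PP us ss rs); last by near: n.
rewrite -(big_map (Y^~ n) xpredT (fun y => q.[y] ^+ 2 / Kdiag P n y)).
apply: ler_sum_subseq => //.
- rewrite map_inj_in_uniq// => x z xF zF Yxz; apply/eqP; apply: contraT => xz.
  suff : Y x n != Y z n by rewrite Yxz eqxx.
  by move: (x) xF (z) zF xz; near: n.
- by move=> _ /mapP[x xF ->]; move: (x) xF; near: n.
- by move=> x _; rewrite divr_ge0 ?sqr_ge0// ltW.
Unshelve. all: by end_near. Qed.

(** Two nodes of one quadrature have orthogonal kernels. The squared distance of
    these is therefore [Kdiag n x + Kdiag n y], which is at least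
    [2 / L 1], while the kernels are locally Lipschitz in the point. *)
Lemma nodes_separated (r : R) n (x y : R) : `|x| <= r -> `|y| <= r ->
  x \in s n -> y \in s n -> x != y -> 2 / (L 1 * M r) <= (x - y) ^+ 2.
Proof.
move=> xr yr xs ys xy; have [us ss rs] := s_nodes n.
have n0 : (0 < n)%N by rewrite -ss; case: (s n) xs.
have Mr : 0 < M r by apply: M_gt0; apply: le_trans xr.
rewrite invfM mulrA ler_pdivrMr// [leRHS]mulrC.
apply: le_trans (K_lip n xr yr).
have -> : \sum_(k < n) ((P k).[x] - (P k).[y]) ^+ 2 = Kdiag P n x + Kdiag P n y.
  transitivity (Kdiag P n x + Kdiag P n y - 2 * (Kpoly P n x).[y]); last first.
    by rewrite (Kpoly_roots PP (rs _ xs) (rs _ ys) xy) mulr0 subr0.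
  rewrite horner_Kpoly mulr_sumr -big_split -sumrB/=.
  by apply: eq_bigr => k _; ring.
by have := Kdiag_ge L_pos PP x n0; have := Kdiag_ge L_pos PP y n0; lra.
Qed.

(** The nodes in [[- r, r]] have masses at least [1 / M r] and total mass at most
    [L 1], so their number is bounded, hence constant along the ultrafilter;
    enumerated in a list they converge one by one, and they stay apart by
    [nodes_separated]. The nodes outside contribute at most the last term, as
    [r ^ 2 <= x ^ 2] there. *)
Lemma limit_nodes_exhaust (r : R) : 0 < r -> exists F : seq R,
  [/\ uniq F, forall x, x \in F -> limit_node x &
   forall q : {poly R}, L (q ^+ 2) <=
     \sum_(x <- F) q.[x] ^+ 2 / Kdiag_lim x + L (('X * q) ^+ 2) / r ^+ 2].
Proof.
move=> r0.
have Mr : 0 < M r by apply: M_gt0; exact: ltW.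
pose l n := [seq x <- s n | `|x| <= r].
have ls n x : x \in l n -> x \in s n /\ `|x| <= r by rewrite mem_filter => /andP[].
have ul n : uniq (l n) by have [us _ _] := s_nodes n; exact: filter_uniq.
have size_l : \forall n \near U, (size (l n) <= Num.bound (L 1 * M r)%R)%N.
  near=> n; have [us ss rs] := s_nodes n.
  have n0 : (0 < n)%N by near: n; exact: U_ge.
  have Kn x : 0 < Kdiag P n x by exact: (Kdiag_gt0 L_pos PP).
  have := gauss_parseval L_pos PP us ss rs (q := (1 : {poly R})%R).
  rewrite size_poly1 => /(_ n0); rewrite expr1n => L1E.
  have h : (size (l n))%:R / M r <= L 1.
    rewrite L1E.
    apply: (@le_trans _ _ (\sum_(x <- l n) (1 : {poly R}).[x] ^+ 2 / Kdiag P n x)); last first.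
      apply: ler_sum_subseq => //; first by move=> x /ls[].
      by move=> x _; rewrite divr_ge0 ?sqr_ge0// ltW.
    rewrite -sum1_size natr_sum mulr_suml big_seq [leRHS]big_seq.
    apply: ler_sum => x /ls[_ xr]; rewrite hornerC expr1n !mul1r.
    by rewrite lef_pV2 ?posrE// K_le.
  rewrite -(ler_nat R); apply: (le_trans _ (ltW (archi_boundP _))).
    by rewrite -ler_pdivrMr.
  by rewrite mulr_ge0// ltW.
have [m ml] := ultra_const_nat UF size_l.
pose y i n := nth 0 (l n) i.
have yl i : (i < m)%N -> \forall n \near U, y i n \in l n.
  by move=> im; apply: filterS ml => n E; rewrite mem_nth ?E.
have /choice[X HX] : forall i, exists x : R, (i < m)%N -> y i n @[n --> U] --> x.
  move=> i; have [im|im] := boolP (i < m)%N; last by exists 0.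
  have [|x yx] := @ultra_bounded_cvg R _ U UF (y i) r; last by exists x.
  by apply: filterS (yl i im) => n /ls[].
have Xneq i j : (i < m)%N -> (j < m)%N -> i != j -> X i != X j.
  move=> im jm ij.
  have cd : (y i n - y j n) ^+ 2 @[n --> U] --> (X i - X j) ^+ 2.
    have cd : (y i n - y j n) @[n --> U] --> X i - X j by apply: cvgB; exact: HX.
    by under eq_fun do rewrite expr2; rewrite expr2; exact: cvgM.
  have : 2 / (L 1 * M r) <= (X i - X j) ^+ 2.
    apply: (cvgr_to_ge cd); near=> n.
    have [] := ls n (y i n); first by near: n; exact: (yl i im).
    have [] := ls n (y j n); first by near: n; exact: (yl j jm).
    move=> js jr is' ir; apply: nodes_separated ir jr is' js _.
    have E : size (l n) = m by near: n.
    by rewrite /y nth_uniq ?E.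
  apply: contraTneq => ->; rewrite subrr expr0n/= -ltNge.
  by rewrite divr_gt0// mulr_gt0.
exists [seq X i | i <- iota 0 m]; split.
- rewrite map_inj_in_uniq ?iota_uniq// => i j; rewrite !mem_iota/= add0n => im jm.
  by apply: contra_eq; exact: Xneq.
- move=> _ /mapP[i + ->]; rewrite mem_iota/= add0n => im.
  exists (y i); last exact: HX.
  by apply: filterS (yl i im) => n /ls[].
- move=> q; rewrite big_map.
  set tail := L (('X * q) ^+ 2) / r ^+ 2.
  have cv : \sum_(i <- iota 0 m) q.[y i n] ^+ 2 / Kdiag P n (y i n) + tail @[n --> U]
      --> \sum_(i <- iota 0 m) q.[X i] ^+ 2 / Kdiag_lim (X i) + tail.
    apply: cvgD; last exact: cvg_cst.
    apply: cvg_sum_seq => i iI; apply: mass_cvg_nodes; apply: HX.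
    by move: iI; rewrite mem_iota.
  apply: (cvgr_to_ge cv); near=> n.
  have [us ss rs] := s_nodes n.
  have E : size (l n) = m by near: n.
  have n0 : (0 < n)%N by near: n; exact: U_ge.
  have Kn x : 0 < Kdiag P n x by exact: (Kdiag_gt0 L_pos PP).
  have sXq : (size ('X * q)%R <= n)%N by near: n; exact: U_ge.
  have sq : (size q <= n)%N by near: n; exact: U_ge.
  rewrite (gauss_parseval L_pos PP us ss rs sq).
  rewrite /tail (gauss_parseval L_pos PP us ss rs sXq).
  rewrite (bigID (fun x => `|x| <= r))/= lerD//.
    by rewrite -big_filter -/(l n) (big_nth 0) /index_iota subn0 E.
  rewrite mulr_suml [leRHS](bigID (fun x => `|x| <= r))/= ler_wpDl//.
    by apply: sumr_ge0 => x _; rewrite !divr_ge0 ?sqr_ge0// ltW.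
  apply: ler_sum => x; rewrite -ltNge => rx.
  rewrite hornerM hornerX exprMn ler_pdivlMr ?exprn_gt0//.
  rewrite -[leRHS]mulrA [leRHS]mulrC ler_wpM2l//.
    by rewrite divr_ge0 ?sqr_ge0// ltW.
  by rewrite -[x ^+ 2]real_normK ?num_real// lerXn2r ?nnegrE// ltW.
Unshelve. all: by end_near. Qed.

End LimitOfQuadratures.

(** * Moment functionals and square integrals *)

Section MomentFunctional.
Variables (R : realType) (gamma : nat -> R).

Definition moment_functional (p : {poly R}) : R :=
  \sum_(i < size p) p`_i * gamma i.

Lemma moment_functionalE n (p : {poly R}) : (size p <= n)%N ->
  moment_functional p = \sum_(i < n) p`_i * gamma i.
Proof.
move=> /subnKC <-; rewrite big_split_ord/= [X in _ + X]big1 ?addr0// => i _.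
by rewrite nth_default ?mul0r// leq_addr.
Qed.

Lemma moment_functional_linear a (p q : {poly R}) :
  moment_functional (a *: p + q) = a * moment_functional p + moment_functional q.
Proof.
pose n := maxn (size p) (size q).
have sp : (size p <= n)%N by exact: leq_maxl.
have sq : (size q <= n)%N by exact: leq_maxr.
rewrite (@moment_functionalE n (a *: p + q)); last first.
  rewrite (leq_trans (size_polyD _ _))// geq_max sq andbT.
  by rewrite (leq_trans (size_scale_leq _ _)).
rewrite (moment_functionalE sp) (moment_functionalE sq) mulr_sumr -big_split/=.
by apply: eq_bigr => i _; rewrite coefD coefZ mulrDl mulrA.
Qed.

HB.instance Definition _ := GRing.isLinear.Build R {poly R} R *%R
  moment_functional moment_functional_linear.

End MomentFunctional.

Local Notation mfun f := (measurable_fun [set: measurableTypeR _] f).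

Section BorelFunctions.
Variable R : realType.

Lemma measurable_horner (p : {poly R}) : mfun (fun t : R => p.[t]).
Proof. by apply: continuous_measurable_fun; exact: continuous_horner. Qed.

Lemma measurable_sqrE (f : R -> R) : mfun f ->
  measurable_fun [set: measurableTypeR R] (fun t => (f t ^+ 2)%:E).
Proof. by move=> mf; apply/measurable_EFinP; exact: measurable_funX. Qed.

Definition sqint (mu : borel_measure R) (f : R -> R) : \bar R :=
  (\int[mu]_t (f t ^+ 2)%:E)%E.

Lemma sqint_ge0 mu f : (0 <= sqint mu f)%E.
Proof. by apply: integral_ge0 => t _; rewrite lee_fin sqr_ge0. Qed.

Lemma sqint_le mu (f g h : R -> R) (c d : R) : 0 <= c -> 0 <= d ->
  mfun f -> mfun g -> mfun h ->
  (forall t, f t ^+ 2 <= c * g t ^+ 2 + d * h t ^+ 2) ->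
  (sqint mu f <= c%:E * sqint mu g + d%:E * sqint mu h)%E.
Proof.
move=> c0 d0 mf mg mh fgh.
rewrite /sqint -!ge0_integralZl_EFin//; try by
  [exact: measurable_sqrE|move=> t _; rewrite lee_fin sqr_ge0].
rewrite -ge0_integralD//; first last.
- by apply: measurable_funeM; exact: measurable_sqrE.
- by move=> t _; rewrite -EFinM lee_fin mulr_ge0 ?sqr_ge0.
- by apply: measurable_funeM; exact: measurable_sqrE.
- by move=> t _; rewrite -EFinM lee_fin mulr_ge0 ?sqr_ge0.
apply: ge0_le_integral => //.
- by move=> t _; rewrite lee_fin sqr_ge0.
- exact: measurable_sqrE.
- by apply: emeasurable_funD; apply: measurable_funeM; exact: measurable_sqrE.
- by move=> t _; rewrite -!EFinM -EFinD lee_fin.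
Qed.

Lemma sqint_le1 mu (f g : R -> R) (c : R) : 0 <= c -> mfun f -> mfun g ->
  (forall t, f t ^+ 2 <= c * g t ^+ 2) -> (sqint mu f <= c%:E * sqint mu g)%E.
Proof.
move=> c0 mf mg fg; have := @sqint_le mu f g g c 0 c0 (lexx 0) mf mg mg.
rewrite mul0e adde0; apply => t.
by rewrite mul0r addr0.
Qed.

End BorelFunctions.

Section RepresentingMeasure.
Variables (R : realType) (gamma : nat -> R) (mu : borel_measure R).
Hypothesis mu_rep : H_representing gamma mu.
Let L := moment_functional gamma.

Lemma integrable_monomial n :
  mu.-integrable [set: measurableTypeR R] (fun t => (t ^+ n)%:E).
Proof.
apply/integrableP; split.
  apply/measurable_EFinP.
  by have := @measurable_horner R 'X^n; under eq_fun do rewrite hornerXn.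
have [+ _] := mu_rep n; apply: le_lt_trans; rewrite le_eqVlt; apply/orP; left.
by apply/eqP; apply: eq_integral => t _; rewrite abse_EFin normrX.
Qed.

Lemma integrable_horner (p : {poly R}) :
  mu.-integrable [set: measurableTypeR R] (fun t => p.[t]%:E).
Proof.
under eq_fun do rewrite horner_coef -sumEFin.
apply: integrable_sum => // i _.
by under eq_fun do rewrite EFinM; apply: integrableZl => //; exact: integrable_monomial.
Qed.

Lemma integral_horner (p : {poly R}) : (\int[mu]_t p.[t]%:E = (L p)%:E)%E.
Proof.
under eq_integral do rewrite horner_coef -sumEFin.
rewrite integral_sum//; last first.
  move=> i; under eq_fun do rewrite EFinM.
  by apply: integrableZl => //; exact: integrable_monomial.
rewrite /L /moment_functional -sumEFin; apply: eq_bigr => i _.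
under eq_integral do rewrite EFinM.
by rewrite integralZl//; [have [_ <-] := mu_rep i; rewrite -EFinM|exact: integrable_monomial].
Qed.

Lemma sqint_horner (p : {poly R}) : sqint mu (fun t => p.[t]) = (L (p ^+ 2))%:E.
Proof.
by rewrite -integral_horner; apply: eq_integral => t _; rewrite horner_exp.
Qed.

Lemma rep_setT : mu [set: measurableTypeR R] = (L 1)%:E.
Proof.
rewrite -integral_horner; under eq_integral do rewrite hornerC.
by rewrite (integral_cst mu measurableT 1%:E) mul1e.
Qed.

Lemma rep_finite (A : set (measurableTypeR R)) : measurable A -> (mu A < +oo)%E.
Proof.
move=> mA; apply: (@le_lt_trans _ _ (mu setT)); last by rewrite rep_setT ltry.
by apply: le_measure; rewrite ?inE.
Qed.

Lemma rep_L_sqr_ge0 (p : {poly R}) : 0 <= L (p ^+ 2).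
Proof. by rewrite -lee_fin -sqint_horner sqint_ge0. Qed.

End RepresentingMeasure.

(** * The L^2-closure of the polynomials *)

Section PolynomialClosure.
Variables (R : realType) (mu : borel_measure R).

(** Membership in the L^2-closure of the real polynomials. *)
Definition poly_approx (f : R -> R) := mfun f /\
  forall eps : R, 0 < eps -> exists p : {poly R},
    (sqint mu (fun t => (f t - p.[t])%R) < eps%:E)%E.

Let sqr_addr_le (a b : R) : (a + b) ^+ 2 <= 2 * a ^+ 2 + 2 * b ^+ 2.
Proof. by have := sqr_ge0 (a - b); rewrite !expr2; lra. Qed.

Let mfunBp (f : R -> R) (p : {poly R}) : mfun f -> mfun (fun t => f t - p.[t]).
Proof. by move=> mf; apply: measurable_funB => //; exact: measurable_horner. Qed.

Lemma poly_approx_horner (p : {poly R}) : poly_approx (fun t => p.[t]).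
Proof.
split=> [|eps eps0]; first exact: measurable_horner.
exists p; rewrite /sqint; under eq_integral do rewrite subrr expr0n.
by rewrite integral0.
Qed.

Lemma poly_approx_closed (f : R -> R) : mfun f ->
  (forall eps, 0 < eps -> exists2 g, poly_approx g &
    (sqint mu (fun t => (f t - g t)%R) < eps%:E)%E) -> poly_approx f.
Proof.
move=> mf h; split => // eps eps0.
have e4 : 0 < eps / 4 by rewrite divr_gt0.
have [g [mg gp] fg] := h _ e4; have [p gp'] := gp _ e4; exists p.
apply: (@le_lt_trans _ _ (2%:E * sqint mu (fun t => (f t - g t)%R) +
    2%:E * sqint mu (fun t => (g t - p.[t])%R))%E).
  apply: sqint_le => //.
  - exact: mfunBp.
  - exact: measurable_funB.
  - exact: mfunBp.
  - by move=> t; rewrite -[f t - p.[t]](subrKA (g t)).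
have -> : eps%:E = (2%:E * (eps / 4)%:E + 2%:E * (eps / 4)%:E)%E.
  by rewrite -!EFinM -EFinD; congr (_%:E); field.
by apply: lteD; rewrite lte_pmul2l.
Qed.

Lemma poly_approx_lin c (f g : R -> R) : poly_approx f -> poly_approx g ->
  poly_approx (fun t => c * f t + g t).
Proof.
move=> [mf fa] [mg ga].
have mcf : mfun (fun t => c * f t) by exact: measurable_funM.
split=> [|eps eps0]; first exact: measurable_funD.
have d0 : 0 < 4 * (c ^+ 2 + 1) by rewrite mulr_gt0// ltr_wpDl ?sqr_ge0.
have e0 : 0 < eps / (4 * (c ^+ 2 + 1)) by rewrite divr_gt0.
have [p fp] := fa _ e0; have [q gq] := ga _ e0.
exists (c *: p + q).
apply: (@le_lt_trans _ _ ((2 * c ^+ 2)%:E * sqint mu (fun t => (f t - p.[t])%R) +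
    2%:E * sqint mu (fun t => (g t - q.[t])%R))%E).
  apply: sqint_le => //.
  - by apply: mulr_ge0 => //; exact: sqr_ge0.
  - by apply: mfunBp; exact: measurable_funD.
  - exact: mfunBp.
  - exact: mfunBp.
  - move=> t; rewrite hornerD hornerZ.
    have -> : c * f t + g t - (c * p.[t] + q.[t]) =
      c * (f t - p.[t]) + (g t - q.[t]) by ring.
    by apply: (le_trans (sqr_addr_le _ _)); rewrite exprMn mulrA.
apply: (@le_lt_trans _ _ ((2 * c ^+ 2)%:E * (eps / (4 * (c ^+ 2 + 1)))%:E +
    2%:E * (eps / (4 * (c ^+ 2 + 1)))%:E)%E).
  have c2 : 0 <= 2 * c ^+ 2 by apply: mulr_ge0 => //; exact: sqr_ge0.
  by apply: leeD; apply: lee_wpmul2l; rewrite ?lee_fin//; exact: ltW.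
rewrite -!EFinM -EFinD lte_fin -mulrDl mulrA ltr_pdivrMr// [ltRHS]mulrC.
rewrite ltr_pM2r//; have := sqr_ge0 c; lra.
Qed.

Lemma poly_approxD (f g : R -> R) : poly_approx f -> poly_approx g ->
  poly_approx (fun t => f t + g t).
Proof.
by move=> fa ga; have := poly_approx_lin 1 fa ga; under eq_fun do rewrite mul1r.
Qed.

Lemma poly_approxZ c (f : R -> R) : poly_approx f -> poly_approx (fun t => c * f t).
Proof.
move=> fa; have := poly_approx_lin c fa (poly_approx_horner 0).
by under eq_fun do rewrite horner0 addr0.
Qed.

Definition multiplier (m : R -> R) :=
  forall f, poly_approx f -> poly_approx (fun t => m t * f t).

(** Multiplication by [m] contracts the L^2-norm, so it preserves the closure as
    soon as it maps the polynomials into it. *)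
Lemma multiplier_of_poly (m : R -> R) : mfun m -> (forall t, m t ^+ 2 <= 1) ->
  (forall p : {poly R}, poly_approx (fun t => m t * p.[t])) -> multiplier m.
Proof.
move=> mm m1 mp f [mf fa]; apply: poly_approx_closed.
  exact: measurable_funM.
move=> eps eps0; have [p fp] := fa _ eps0.
exists (fun t => m t * p.[t]) => //.
apply: le_lt_trans fp; rewrite -[leRHS]mul1e; apply: sqint_le1 => //.
- apply: measurable_funB; first exact: measurable_funM.
  by apply: measurable_funM => //; exact: measurable_horner.
- exact: mfunBp.
- by move=> t; rewrite -mulrBr exprMn ler_wpM2r ?sqr_ge0.
Qed.

Lemma multiplier_cst c : multiplier (fun=> c).
Proof. by move=> f; exact: poly_approxZ. Qed.

Lemma multiplierD m n : multiplier m -> multiplier n ->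
  multiplier (fun t => m t + n t).
Proof.
move=> mm nm f fa; under eq_fun do rewrite mulrDl.
by apply: poly_approxD; [exact: mm|exact: nm].
Qed.

Lemma multiplierM m n : multiplier m -> multiplier n ->
  multiplier (fun t => m t * n t).
Proof. by move=> mm nm f /nm /mm; under eq_fun do rewrite mulrA. Qed.

Lemma multiplierX m k : multiplier m -> multiplier (fun t => m t ^+ k).
Proof.
move=> mm; elim: k => [|k IH].
  by under eq_fun do rewrite expr0; exact: multiplier_cst.
by under eq_fun do rewrite exprS; exact: multiplierM.
Qed.

End PolynomialClosure.

(** The polynomials [(1 - x ^ n) ^ (n 2 ^ n)] converge on [[0, 1]] to the
    indicator function of [[0, 1/2[]. *)
Section Threshold.
Variable R : realType.

Definition threshold n (x : R) := (1 - x ^+ n) ^+ (n * 2 ^ n).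

Lemma threshold_itv n x : 0 <= x <= 1 -> 0 <= threshold n x <= 1.
Proof.
move=> /andP[x0 x1].
have xn0 : 0 <= x ^+ n by exact: exprn_ge0.
have xn1 : x ^+ n <= 1 by exact: exprn_ile1.
by rewrite /threshold exprn_ge0 ?exprn_ile1//; lra.
Qed.

Lemma bernoulli_le (y : R) k : 0 <= y -> y <= 1 -> 1 - k%:R * y <= (1 - y) ^+ k.
Proof.
move=> y0 y1; elim: k => [|k IH]; first by rewrite mul0r subr0 expr0.
rewrite exprS -natr1.
have h : 0 <= (1 - y) * ((1 - y) ^+ k - (1 - k%:R * y)).
  by rewrite mulr_ge0 ?subr_ge0.
have : 0 <= k%:R * y * y by rewrite !mulr_ge0.
move: h; set A := (1 - y) ^+ k; set N := k%:R; rewrite !mulrDl !mulrDr; lra.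
Qed.

Lemma bernoulli_ge (y : R) k : 0 <= y -> y <= 1 ->
  (1 - y) ^+ k * (1 + k%:R * y) <= 1.
Proof.
move=> y0 y1.
have h : 1 + k%:R * y <= (1 + y) ^+ k.
  elim: k => [|k IH]; first by rewrite mul0r addr0 expr0.
  rewrite exprS -natr1.
  have h : 0 <= (1 + y) * ((1 + y) ^+ k - (1 + k%:R * y)).
    by rewrite mulr_ge0 ?subr_ge0// addr_ge0.
  have : 0 <= k%:R * y * y by rewrite !mulr_ge0.
  move: h; set A := (1 + y) ^+ k; set N := k%:R; rewrite !mulrDl !mulrDr; lra.
apply: (@le_trans _ _ ((1 - y) ^+ k * (1 + y) ^+ k)).
  by rewrite ler_wpM2l// exprn_ge0// subr_ge0.
rewrite -exprMn exprn_ile1//; last by have := sqr_ge0 y; rewrite !mulrDl !mulrDr expr2; lra.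
by rewrite mulr_ge0 ?subr_ge0// addr_ge0.
Qed.

Lemma threshold_cvg (x : R) : 0 <= x <= 1 ->
  threshold n x @[n --> \oo] --> (((x < 2^-1)%R)%:R : R).
Proof.
move=> /andP[x0 x1].
have xn0 n : 0 <= x ^+ n by exact: exprn_ge0.
have xn1 n : x ^+ n <= 1 by exact: exprn_ile1.
have [xlt|xge] := ltP x 2^-1; last first.
  have cv : (n.+1%:R : R)^-1 @[n --> \oo] --> 0 by exact: cvg_harmonic.
  apply: (squeeze_cvgr _ (cvg_cst 0) cv).
  near=> n.
  have /andP[-> _]/= : 0 <= threshold n x <= 1 by apply: threshold_itv; rewrite x0 x1.
  rewrite -div1r ler_pdivlMr//.
  apply: le_trans (bernoulli_ge (n * 2 ^ n) (xn0 n) (xn1 n)).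
  rewrite /threshold ler_wpM2l//; first by rewrite exprn_ge0// subr_ge0.
  rewrite -natr1 addrC lerD2l natrM natrX -mulrA -exprMn ler_peMr//.
  by apply: exprn_ege1; move: xge; rewrite -ler_pdivrMl ?mulr1.
have x2 : `|2 * x| < 1.
  by rewrite ger0_norm ?mulr_ge0//; move: xlt; rewrite -ltr_pdivlMl ?mulr1.
have cv : (1 - n%:R * (2 * x) ^+ n) @[n --> \oo] --> (1 : R).
  rewrite -[X in _ --> X]subr0; apply: cvgB; first exact: cvg_cst.
  pose z := Num.sqrt (2 * x).
  have z0 : 0 <= z by exact: sqrtr_ge0.
  have zE : z ^+ 2 = 2 * x by rewrite sqr_sqrtr ?mulr_ge0.
  have z1 : z < 1.
    rewrite -(@ltr_pXn2r _ 2%N)// ?nnegrE// zE expr1n.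
    by move: x2; rewrite ger0_norm ?mulr_ge0.
  have zn : z ^+ n / (1 - z) @[n --> \oo] --> (0 : R).
    rewrite -[X in _ --> X](mul0r (1 - z)^-1); apply: cvgM; last exact: cvg_cst.
    by apply: cvg_expr; rewrite ger0_norm.
  apply: (squeeze_cvgr _ (cvg_cst 0) zn).
  near=> n; rewrite mulr_ge0 ?exprn_ge0 ?mulr_ge0//=.
  rewrite ler_pdivlMr ?subr_gt0// -zE -exprM mulnC exprM expr2.
  have := @bernoulli_ge (1 - z) n; rewrite subr_ge0 subKr => /(_ (ltW z1)).
  rewrite lerBlDl lerDr => /(_ z0) h.
  have h1 : z ^+ n * (n%:R * (1 - z)) <= 1.
    by move: h; rewrite mulrDr mulr1; have := exprn_ge0 n z0; lra.
  by have := ler_wpM2l (exprn_ge0 n z0) h1; rewrite mulr1; lra.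
rewrite mulr1n; apply: (squeeze_cvgr _ cv (cvg_cst (1 : R))).
near=> n; have /andP[_ ->]/= : 0 <= threshold n x <= 1.
  by apply: threshold_itv; rewrite x0 x1.
rewrite andbT exprMn mulrA -natrX -natrM; exact: bernoulli_le.
Unshelve. all: by end_near. Qed.

End Threshold.

(** * Unbounded remainders force determinacy *)

Section UnboundedRemainder.
Variables (R : realType) (gamma : nat -> R) (mu nu : borel_measure R).
Hypotheses (mu_rep : H_representing gamma mu) (nu_rep : H_representing gamma nu).
Let L := moment_functional gamma.
Hypothesis rem_unbounded : forall eps, 0 < eps ->
  exists p : {poly R}, L (p ^+ 2) < eps * (rem0 p ^+ 2 + rem1 p ^+ 2).

Let sigma : borel_measure R := measure_add mu nu.

Let sqint_sigma f : mfun f -> sqint sigma f = (sqint mu f + sqint nu f)%E.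
Proof.
move=> mf; rewrite /sqint ge0_integral_measure_add//.
  by move=> t _; rewrite lee_fin sqr_ge0.
exact: measurable_sqrE.
Qed.

Let sqint_sigma_horner (p : {poly R}) :
  sqint sigma (fun t => p.[t]) = (2 * L (p ^+ 2))%:E.
Proof.
rewrite sqint_sigma; last exact: measurable_horner.
by rewrite (sqint_horner mu_rep) (sqint_horner nu_rep) -EFinD; congr (_%:E); ring.
Qed.

Let u (t : R) : R := (t ^+ 2 + 1)^-1.

Let q_gt0 (t : R) : 0 < t ^+ 2 + 1.
Proof. by rewrite ltr_wpDl ?sqr_ge0. Qed.

Let q_neq0 (t : R) : t ^+ 2 + 1 != 0.
Proof. by rewrite gt_eqF. Qed.

Let measurable_u : mfun u.
Proof.
apply: continuous_measurable_fun => t; rewrite /u; apply: cvgV => //.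
apply: cvgD; last exact: cvg_cst.
by under eq_fun do rewrite expr2; rewrite expr2; apply: cvgM; exact: cvg_id.
Qed.

Let mfunXn n : mfun (fun t : R => t ^+ n).
Proof. by have := @measurable_horner R 'X^n; under eq_fun do rewrite hornerXn. Qed.

Let mfunX : mfun (fun t : R => t).
Proof. exact: (mfunXn 1). Qed.

Let approx_core (s : {poly R} -> {poly R}) (f : R -> R) : mfun f ->
  (forall p : {poly R}, rem0 p ^+ 2 + rem1 p ^+ 2 != 0 -> forall t,
    (f t - (s p).[t]) ^+ 2 <= (rem0 p ^+ 2 + rem1 p ^+ 2)^-1 * p.[t] ^+ 2) ->
  poly_approx sigma f.
Proof.
move=> mf sP; split => // eps eps0.
have e2 : 0 < eps / 2 by rewrite divr_gt0.
have [p pP] := rem_unbounded e2.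
set m := _ + _ in pP.
have m0 : 0 < m.
  rewrite -(pmulr_rgt0 _ e2); apply: le_lt_trans pP.
  exact: (rep_L_sqr_ge0 mu_rep).
exists (s p).
apply: (@le_lt_trans _ _ ((m^-1)%:E * sqint sigma (fun t => p.[t]))%E).
  apply: sqint_le1.
  - by rewrite invr_ge0 ltW.
  - by apply: measurable_funB => //; exact: measurable_horner.
  - exact: measurable_horner.
  - by apply: sP; rewrite gt_eqF.
rewrite sqint_sigma_horner -EFinM lte_fin.
rewrite -(ltr_pM2l m0) mulrA mulfV ?gt_eqF// mul1r.
by move: pP; rewrite -/L; set l := L _; lra.
Qed.

(** Let [w] be the value of [p] at the imaginary unit, so that [q = p / w] takes
    the value 1 there. The polynomials [s p] below and in [approx_tu] are the
    imaginary and the real part of the polynomial [(1 - q) / (t - i)], while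
    [u] and [t * u] are those of [1 / (t - i)]; the differences are bounded by
    [|q|]. *)
Lemma approx_u : poly_approx sigma u.
Proof.
pose s (p : {poly R}) := (rem0 p ^+ 2 + rem1 p ^+ 2)^-1 *:
  ((rem1 p *: 'X - (rem0 p)%:P) * quo p + (rem1 p ^+ 2)%:P).
apply: (approx_core (s := s)) => // p m0 t.
have pE : p.[t] = (quo p).[t] * (t ^+ 2 + 1) + (rem1 p * t + rem0 p).
  by rewrite {1}(quadr_divE p) /quadr !hornerE.
move: m0; rewrite /s pE !(hornerZ, hornerD, hornerM, hornerN, hornerX, hornerC).
set a := rem1 p; set b := rem0 p; set q := (quo p).[t] => m0.
have -> : u t - (b ^+ 2 + a ^+ 2)^-1 * ((a * t - b) * q + a ^+ 2) =
  (b ^+ 2 + a ^+ 2)^-1 * ((b - a * t) * u t) * (q * (t ^+ 2 + 1) + (a * t + b)).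
  by rewrite /u; field; rewrite m0 q_neq0.
rewrite exprMn ler_wpM2r ?sqr_ge0// exprMn expr2 -mulrA ler_piMr//.
  by rewrite invr_ge0 addr_ge0 ?sqr_ge0.
rewrite ler_pdivrMl; last by rewrite lt_neqAle eq_sym m0 addr_ge0 ?sqr_ge0.
rewrite mulr1 exprMn /u exprVn ler_pdivrMr ?exprn_gt0//.
have h : (b - a * t) ^+ 2 <= (b ^+ 2 + a ^+ 2) * (t ^+ 2 + 1).
  by have := sqr_ge0 (b * t + a); lra.
apply: (le_trans h); rewrite ler_wpM2l ?addr_ge0 ?sqr_ge0//.
by rewrite ler_eXnr// lerDr sqr_ge0.
Qed.

Lemma approx_tu : poly_approx sigma (fun t => t * u t).
Proof.
pose s (p : {poly R}) := - (rem0 p ^+ 2 + rem1 p ^+ 2)^-1 *: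
  ((rem0 p *: 'X + (rem1 p)%:P) * quo p + (rem1 p * rem0 p)%:P).
apply: (approx_core (s := s)); first exact: measurable_funM.
move=> p m0 t.
have pE : p.[t] = (quo p).[t] * (t ^+ 2 + 1) + (rem1 p * t + rem0 p).
  by rewrite {1}(quadr_divE p) /quadr !hornerE.
move: m0; rewrite /s pE !(hornerZ, hornerD, hornerM, hornerN, hornerX, hornerC).
set a := rem1 p; set b := rem0 p; set q := (quo p).[t] => m0.
have -> : t * u t - - (b ^+ 2 + a ^+ 2)^-1 * ((b * t + a) * q + a * b) =
  (b ^+ 2 + a ^+ 2)^-1 * ((b * t + a) * u t) * (q * (t ^+ 2 + 1) + (a * t + b)).
  by rewrite /u; field; rewrite m0 q_neq0.
rewrite exprMn ler_wpM2r ?sqr_ge0// exprMn expr2 -mulrA ler_piMr//.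
  by rewrite invr_ge0 addr_ge0 ?sqr_ge0.
rewrite ler_pdivrMl; last by rewrite lt_neqAle eq_sym m0 addr_ge0 ?sqr_ge0.
rewrite mulr1 exprMn /u exprVn ler_pdivrMr ?exprn_gt0//.
have h : (b * t + a) ^+ 2 <= (b ^+ 2 + a ^+ 2) * (t ^+ 2 + 1).
  by have := sqr_ge0 (b - a * t); lra.
apply: (le_trans h); rewrite ler_wpM2l ?addr_ge0 ?sqr_ge0//.
by rewrite ler_eXnr// lerDr sqr_ge0.
Qed.

Lemma approx_poly_u (p : {poly R}) : poly_approx sigma (fun t => u t * p.[t]).
Proof.
have -> : (fun t => u t * p.[t]) =
   (fun t => (quo p).[t] + (rem1 p * (t * u t) + rem0 p * u t)).
  apply/funext => t; rewrite {1}(quadr_divE p) /quadr !hornerE/= /u.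
  by field; exact: q_neq0.
apply: poly_approxD; first exact: poly_approx_horner.
by apply: poly_approxD; apply: poly_approxZ; [exact: approx_tu|exact: approx_u].
Qed.

Let u_itv t : 0 <= u t <= 1.
Proof. by rewrite invr_ge0 ltW//= invf_le1// lerDr sqr_ge0. Qed.

Lemma multiplier_u : multiplier sigma u.
Proof.
apply: multiplier_of_poly => //; last exact: approx_poly_u.
by move=> t; have /andP[u0 u1] := u_itv t; rewrite exprn_ile1.
Qed.

Lemma multiplier_tu : multiplier sigma (fun t => t * u t).
Proof.
apply: multiplier_of_poly => [||p]; first exact: measurable_funM.
  move=> t; rewrite exprMn /u exprVn ler_pdivrMr ?exprn_gt0// mul1r.
  rewrite (@le_trans _ _ (t ^+ 2 + 1))// ?lerDl//.
  by rewrite ler_eXnr// lerDr sqr_ge0.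
have := approx_poly_u ('X * p).
by under eq_fun do rewrite hornerM hornerX mulrCA mulrA.
Qed.

(** The integral is continuous in the L^2-seminorm of a finite measure; the
    elementary bound [|d| <= th / 2 + d ^ 2 / (2 th)], integrated, plays the
    part of the Cauchy-Schwarz inequality. *)
Lemma approx_integral_eq (f : R -> R) : poly_approx sigma f ->
  (forall t, 0 <= f t <= 1) ->
  (\int[mu]_t (f t)%:E = \int[nu]_t (f t)%:E)%E.
Proof.
move=> [mf fa] f01.
have fint (m : borel_measure R) : H_representing gamma m ->
    m.-integrable setT (fun t => (f t)%:E).
  move=> mrep; apply: (@le_integrable _ _ _ m _ measurableT _
    (fun t => (1%:P : {poly R}).[t]%:E)).
  - exact/measurable_EFinP.
  - move=> t _; rewrite hornerC !abse_EFin lee_fin normr1.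
    by have /andP[f0 f1] := f01 t; rewrite ger0_norm.
  - exact: (integrable_horner mrep).
have key (m : borel_measure R) (p : {poly R}) (th eps : R) :
    H_representing gamma m -> 0 < th ->
    (sqint m (fun t => (f t - p.[t])%R) <= eps%:E)%E ->
    `|fine (\int[m]_t (f t)%:E)%E - L p| <= th * L 1 / 2 + eps / (2 * th).
  move=> mrep th0 hp.
  have mfp : mfun (fun t => f t - p.[t]).
    by apply: measurable_funB => //; exact: measurable_horner.
  have E : (\int[m]_t (f t - p.[t])%:E = (fine (\int[m]_t (f t)%:E) - L p)%:E)%E.
    under eq_integral do rewrite EFinB.
    rewrite integralB_EFin//; [|exact: fint|exact: integrable_horner mrep p].
    rewrite (integral_horner mrep) EFinB fineK//.
    by apply: integrable_fin_num => //; exact: fint.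
  rewrite -lee_fin -abse_EFin -E.
  apply: (le_trans (le_abse_integral _ _ _)) => //; first exact/measurable_EFinP.
  have c1 : 0 <= th / 2 by rewrite divr_ge0// ltW.
  have c2 : 0 <= (2 * th)^-1 by rewrite invr_ge0 mulr_ge0// ltW.
  have m2 := measurable_sqrE mfp.
  apply: (@le_trans _ _ (\int[m]_t ((th / 2)%:E +
      (2 * th)^-1%:E * ((f t - p.[t]) ^+ 2)%:E))%E).
    apply: ge0_le_integral => //.
    - by apply/measurable_EFinP; exact: measurableT_comp.
    - by apply: emeasurable_funD => //; exact: measurable_funeM.
    - move=> t _; rewrite abse_EFin -EFinM -EFinD lee_fin.
      set d := f t - p.[t].
      rewrite -[d ^+ 2]real_normK ?num_real//.
      have := mulr_ge0 c2 (sqr_ge0 (`|d| - th)).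
      have -> : (2 * th)^-1 * (`|d| - th) ^+ 2 =
        th / 2 + (2 * th)^-1 * `|d| ^+ 2 - `|d| by field; rewrite gt_eqF.
      by rewrite subr_ge0.
  rewrite ge0_integralD//; last 2 first.
  - by move=> t _; rewrite -EFinM lee_fin mulr_ge0// sqr_ge0.
  - exact: measurable_funeM.
  rewrite (integral_cst m measurableT (th / 2)%:E) (rep_setT mrep).
  rewrite ge0_integralZl_EFin//; last by move=> t _; rewrite lee_fin sqr_ge0.
  rewrite EFinD; apply: leeD; first by rewrite -EFinM lee_fin mulrAC.
  have -> : (eps / (2 * th))%:E = ((2 * th)^-1%:E * eps%:E)%E by rewrite -EFinM mulrC.
  by apply: lee_wpmul2l => //; rewrite lee_fin.
have fin m : H_representing gamma m -> ((\int[m]_t (f t)%:E)%E \is a fin_num).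
  by move=> mrep; apply: integrable_fin_num => //; exact: fint.
rewrite -(fineK (fin _ mu_rep)) -(fineK (fin _ nu_rep)); congr (_%:E).
set a := fine _; set b := fine _.
apply/eqP; rewrite -subr_eq0 -normr_le0; apply/ler_addgt0Pl => e e0; rewrite addr0.
have L1 : 0 <= L 1 by have := rep_L_sqr_ge0 mu_rep 1; rewrite expr1n.
pose th := e / (L 1 + 1).
have th0 : 0 < th by rewrite divr_gt0// ltr_wpDl.
have [p hp] := fa (th ^+ 2) (exprn_gt0 _ th0).
move: hp; rewrite sqint_sigma => [/ltW hp|]; last first.
  by apply: measurable_funB => //; exact: measurable_horner.
have hpm : (sqint mu (fun t => (f t - p.[t])%R) <= (th ^+ 2)%:E)%E.
  by apply: le_trans hp; apply: leeDl; exact: sqint_ge0.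
have hpn : (sqint nu (fun t => (f t - p.[t])%R) <= (th ^+ 2)%:E)%E.
  by apply: le_trans hp; apply: leeDr; exact: sqint_ge0.
have := key mu p th _ mu_rep th0 hpm; have := key nu p th _ nu_rep th0 hpn.
rewrite -/a -/b.
have -> : th ^+ 2 / (2 * th) = th / 2 by field; rewrite gt_eqF.
have -> : th * L 1 / 2 + th / 2 = e / 2.
  by rewrite /th; field; rewrite gt_eqF// ltr_wpDl.
move=> h1 h2.
have -> : a - b = (a - L p) - (b - L p) by ring.
apply: (le_trans (ler_normB _ _)); lra.
Qed.


Let M (x : R) := 1 + `|x|.
(** The function [g x] takes its values in [[0, 1]] and is below 1/2 exactly to
    the right of [x], so that [threshold n] turns it into the indicator
    function of a half-line while staying in the algebra generated by [u] and
    [t * u]. *)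
Let g (x t : R) := 2^-1 + (- (2 * M x)^-1 * (t * u t) + x / (2 * M x) * u t).

Let M_gt0 x : 0 < M x.
Proof. by rewrite /M ltr_pwDl. Qed.

Let gE x t : g x t = 2^-1 - (t - x) / (2 * M x) * u t.
Proof. by rewrite /g; ring. Qed.

Let g_itv x t : 0 <= g x t <= 1.
Proof.
have h : `|(t - x) * u t| <= M x.
  have /andP[u0 u1] := u_itv t.
  rewrite mulrBl (le_trans (ler_normB _ _))// !normrM (ger0_norm u0) lerD//.
    rewrite /u ler_pdivrMr// mul1r.
    have := sqr_ge0 (`|t| - 2^-1); rewrite -[t ^+ 2]real_normK ?num_real//.
    by rewrite !expr2; lra.
  by rewrite ler_piMr.
rewrite gE mulrAC.
have h2 : `|(t - x) * u t / (2 * M x)| <= 2^-1.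
  rewrite normrM (gtr0_norm (_ : 0 < (2 * M x)^-1)) ?invr_gt0 ?mulr_gt0//.
  by rewrite ler_pdivrMr ?mulr_gt0// mulrA mulVf// mul1r.
by move: h2; rewrite ler_norml => /andP[]; lra.
Qed.

Let g_lt x t : (g x t < 2^-1) = (x < t).
Proof.
have /andP[u0 _] := u_itv t.
have up : 0 < u t by rewrite invr_gt0.
rewrite gE gtrBl pmulr_lgt0// pmulr_lgt0 ?subr_gt0// invr_gt0 mulr_gt0//.
Qed.

Let multiplier_threshold x n : multiplier sigma (fun t => threshold n (g x t)).
Proof.
have mg : multiplier sigma (g x).
  apply: multiplierD; first exact: multiplier_cst.
  apply: multiplierD; apply: multiplierM; try exact: multiplier_cst.
    exact: multiplier_tu.
  exact: multiplier_u.
apply: multiplierX.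
under eq_fun do rewrite -[- _]mulN1r.
apply: multiplierD; first exact: multiplier_cst.
by apply: multiplierM; [exact: multiplier_cst|exact: multiplierX].
Qed.

Let integral_threshold_cvg x (m : borel_measure R) : H_representing gamma m ->
  (\int[m]_t (threshold n (g x t))%:E)%E @[n --> \oo] --> m `]x, +oo[%classic.
Proof.
move=> mrep.
have mth n : mfun (fun t => threshold n (g x t)).
  have := multiplier_threshold x n (poly_approx_horner sigma 1).
  by move=> [+ _]; under eq_fun do rewrite hornerC mulr1.
have -> : m `]x, +oo[%classic = (\int[m]_t ((\1_(`]x, +oo[%classic) t : R)%:E))%E.
  by rewrite integral_indic// setIT.
apply: (@dominated_cvg _ _ _ m _ measurableT _ _ (fun t => (1%:P : {poly R}).[t]%:E)).
- by move=> n; exact/measurable_EFinP.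
- move=> t _; apply: cvg_EFin; first exact: nearW.
  rewrite indicE mem_setE in_itv/= andbT -g_lt.
  exact: threshold_cvg.
- by [].
- exact: (integrable_horner mrep).
- move=> n t _; rewrite hornerC abse_EFin lee_fin.
  by have /andP[h0 h1] := threshold_itv n (g_itv x t); rewrite ger0_norm.
Qed.

(** Half-lines generate the Borel sets, and their indicator functions are bounded
    limits of [threshold n (g x t)], which both measures integrate alike. *)
Lemma determinate_of_unbounded_remainder (A : set (measurableTypeR R)) :
  measurable A -> mu A = nu A.
Proof.
apply: (@measure_unique _ R (measurableTypeR R) (@RGenOInfty.G R)
  (fun n => `](- n%:R : R), +oo[%classic) (RGenOInfty.measurableE R)).
- move=> _ _ [x ->] [y ->]; exists (Num.max x y).
  apply/seteqP; split => t/=; rewrite !in_itv/= !andbT gt_max.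
    by move=> [-> ->].
  by move=> /andP[].
- by move=> n; exists (- n%:R).
- apply/seteqP; split => // t _; exists (Num.bound `|t|) => //=.
  rewrite in_itv/= andbT ltrNl (le_lt_trans (ler_norm _))// normrN.
  exact: archi_boundP.
- move=> _ [x ->].
  apply: (cvg_unique (@ereal_hausdorff R) (integral_threshold_cvg (x := x) mu_rep)).
  have -> : (fun n => \int[mu]_t (threshold n (g x t))%:E)%E =
      (fun n => \int[nu]_t (threshold n (g x t))%:E)%E.
    apply/funext => n; apply: approx_integral_eq; last first.
      by move=> t; exact/threshold_itv/g_itv.
    have := multiplier_threshold x n (poly_approx_horner sigma 1).
    by under eq_fun do rewrite hornerC mulr1.
  exact: integral_threshold_cvg.
- by move=> n; apply: (rep_finite mu_rep).
Qed.

End UnboundedRemainder.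

(** * Measures carried by limit nodes *)

(** The quantitative form in which indeterminacy is used from here on. *)
Lemma rem_bounded_of_indeterminate (R : realType) (gamma : nat -> R) :
  H_indeterminate gamma -> exists C, forall p : {poly R},
    rem0 p ^+ 2 + rem1 p ^+ 2 <= C * moment_functional gamma (p ^+ 2).
Proof.
move=> [mu [nu [mu_rep nu_rep [A mA neq]]]].
apply: contrapT => h; apply: neq.
apply: (determinate_of_unbounded_remainder mu_rep nu_rep) => // eps eps0.
apply: contrapT => h2; apply: h; exists eps^-1 => p.
rewrite -ler_pdivrMl ?invr_gt0// invrK leNgt; apply/negP => h3.
by apply: h2; exists p.
Qed.

Section AtomicMeasure.
Variables (R : realType) (a : nat -> R) (c : nat -> {nonneg R}).

Definition atomic_measure : borel_measure R :=
  mseries (fun k => mscale (c k) (dirac (a k : measurableTypeR R))) 0.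

Lemma integral_atomic (h : R -> R) : mfun h -> (forall t, 0 <= h t) ->
  (\int[atomic_measure]_t (h t)%:E =
   \sum_(0 <= k <oo) ((c k)%:num * h (a k))%:E)%E.
Proof.
move=> mh h0; have mhE : measurable_fun [set: measurableTypeR R] (fun t => (h t)%:E).
  exact/measurable_EFinP.
rewrite ge0_integral_measure_series//; last by move=> t _; rewrite lee_fin.
apply: eq_eseriesr => k _.
rewrite ge0_integral_mscale//; last by move=> t _; rewrite lee_fin.
by rewrite integral_dirac// diracT mul1e -EFinM.
Qed.

End AtomicMeasure.

Section NExtremalConstruction.
Variables (R : realType) (gamma : nat -> R) (w : R -> R) (X : set R).
Let L := moment_functional gamma.
Hypothesis w_gt0 : forall x, 0 < w x.
Hypothesis X_countable : countable X.
Hypothesis bessel : forall (F : seq R) (q : {poly R}), uniq F ->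
  (forall x, x \in F -> X x) -> \sum_(x <- F) q.[x] ^+ 2 * w x <= L (q ^+ 2).
Hypothesis parseval : forall (q : {poly R}) (eps : R), 0 < eps ->
  exists F : seq R, [/\ uniq F, forall x, x \in F -> X x &
    L (q ^+ 2) <= \sum_(x <- F) q.[x] ^+ 2 * w x + eps].
(** Once [w x] is the mass at [x], the left-hand side is the squared L^2-distance
    of [q] to the indicator function of [x]. *)
Hypothesis peak : forall (x eps : R), X x -> 0 < eps ->
  exists q : {poly R}, L (q ^+ 2) - 2 * q.[x] * w x + w x < eps.

(** An enumeration of the atoms, in which the indices that are not used get
    weight zero. *)
Let enumeration : exists (a : nat -> R) (c : nat -> {nonneg R}),
  [/\ forall k, 0 < (c k)%:num -> X (a k) /\ (c k)%:num = w (a k),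
      forall x, X x -> exists2 k, 0 < (c k)%:num & a k = x &
      forall i j, 0 < (c i)%:num -> 0 < (c j)%:num -> a i = a j -> i = j].
Proof.
have /countable_injP[f finj] := X_countable.
pose Q k := [set x | X x /\ f x = k].
pose a k := xget 0 (Q k).
have wn x : 0 <= w x by exact/ltW.
pose c k : {nonneg R} :=
  if `[< exists x, Q k x >] then NngNum (wn (a k)) else NngNum (lexx (0 : R)).
have cP k : 0 < (c k)%:num -> Q k (a k) /\ (c k)%:num = w (a k).
  rewrite /c; case: asboolP => [[x Qx] _|_]; last by rewrite ltxx.
  by split=> //; exact: (xgetPex 0 (ex_intro _ x Qx)).
exists a, c; split.
- by move=> k /cP[[]].
- move=> x Xx; exists (f x); last first.
    have [Xa fa] : Q (f x) (a (f x)) by exact: (xgetPex 0 (ex_intro _ x (conj Xx erefl))).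
    by apply: finj; rewrite ?inE.
  rewrite /c; case: asboolP => [_|nx]; first exact: w_gt0.
  by exfalso; apply: nx; exists x.
- by move=> i j /cP[[_ fi] _] /cP[[_ fj] _] aij; rewrite -fi -fj aij.
Qed.

(** The measure with mass [w x] at each [x] of [X] has the right moments because
    [t ^ n] is a difference of squares of polynomials. Polynomials are dense
    since every atom is approximated in the sense of [peak] and finite
    combinations of atoms exhaust L^2. *)
Lemma exists_N_extremal_atomic : exists nu : borel_measure R,
  H_representing gamma nu /\
  forall f, mfun f -> (sqint nu f < +oo)%E -> poly_approx nu f.
Proof.
have [a [c [cw Xa inj]]] := enumeration.
pose nu := atomic_measure a c; exists nu.
pose valid k := 0 < (c k)%:num.
have notvalid k : ~~ valid k -> (c k)%:num = 0.
  by rewrite /valid -leNgt => h; apply/eqP; rewrite eq_le h/=.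
pose FN N := [seq a k | k <- iota 0 N & valid k].
have FNu N : uniq (FN N).
  rewrite map_inj_in_uniq ?filter_uniq ?iota_uniq// => i j.
  by rewrite !mem_filter => /andP[vi _] /andP[vj _]; exact: inj.
have FNX N x : x \in FN N -> X x.
  by move=> /mapP[k]; rewrite mem_filter => /andP[/cw[+ _] _] ->.
have FNsum N (h : R -> R) :
    \sum_(0 <= k < N) (c k)%:num * h (a k) = \sum_(x <- FN N) h x * w x.
  rewrite /FN big_map big_filter [RHS]big_mkcond/= /index_iota subn0.
  apply: eq_bigr => k _; case: ifPn => [/cw[_ ->]|/notvalid ->]; first by rewrite mulrC.
  by rewrite mul0r.
have int_le (h : R -> R) b : mfun h -> (forall t, 0 <= h t) ->
    (forall N, \sum_(x <- FN N) h x * w x <= b) ->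
    (\int[nu]_t (h t)%:E <= b%:E)%E.
  move=> mh h0 hb; rewrite integral_atomic//.
  apply: lime_le.
    by apply: is_cvg_nneseries => k _ _; rewrite lee_fin mulr_ge0.
  by apply: nearW => N; rewrite sumEFin lee_fin FNsum.
have int_ge (h : R -> R) (F : seq R) : mfun h -> (forall t, 0 <= h t) ->
    uniq F -> (forall x, x \in F -> X x) ->
    ((\sum_(x <- F) h x * w x)%:E <= \int[nu]_t (h t)%:E)%E.
  move=> mh h0 uF FX; rewrite integral_atomic//.
  have [N FN_sub] : exists N, {subset F <= FN N}.
    elim: F {uF} FX => [|x F IH] FX; first by exists 0%N.
    have [|N HN] := IH; first by move=> y yF; apply: FX; rewrite inE yF orbT.
    have [k ck akx] := Xa x (FX x (mem_head _ _)).
    exists (maxn N k.+1) => y; rewrite inE => /predU1P[->|/HN].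
      apply/mapP; exists k => //; rewrite mem_filter /valid ck mem_iota/= add0n.
      by rewrite leq_max ltnSn orbT.
    move=> /mapP[j]; rewrite mem_filter mem_iota/= add0n => /andP[vj jN] ->.
    apply/mapP; exists j => //; rewrite mem_filter vj mem_iota/= add0n.
    by rewrite leq_max jN.
  apply: (@le_trans _ _ (\sum_(0 <= k < N) ((c k)%:num * h (a k))%:E)%E).
    rewrite sumEFin lee_fin FNsum; apply: ler_sum_subseq => //.
    by move=> x _; rewrite mulr_ge0// ltW.
  by apply: nneseries_lim_ge => k _ _; rewrite lee_fin mulr_ge0.
have nu_sqr (q : {poly R}) : sqint nu (fun t => q.[t]) = (L (q ^+ 2))%:E.
  have mq : mfun (fun t => q.[t] ^+ 2).
    by apply: measurable_funX; exact: measurable_horner.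
  have q0 (t : R) : 0 <= q.[t] ^+ 2 by exact: sqr_ge0.
  apply/eqP; rewrite eq_le; apply/andP; split.
    by apply: int_le => // N; apply: bessel => // x; exact: FNX.
  apply/lee_addgt0Pr => e e0.
  have [F [uF FX hF]] := parseval q e0.
  apply: (@le_trans _ _ ((\sum_(x <- F) q.[x] ^+ 2 * w x)%:E + e%:E)%E).
    by rewrite -EFinD lee_fin.
  by rewrite leeD2r//; exact: int_ge.
have peak_approx x : X x -> poly_approx nu (fun t => (t == x)%:R).
  move=> Xx.
  have md : mfun (fun t : R => (t == x)%:R : R).
    have -> : (fun t : R => (t == x)%:R : R) = \1_[set x].
      apply/funext => t; rewrite indicE (_ : (t \in [set x]) = (t == x))//.
      by apply/idP/eqP => [|->]; rewrite inE.
    exact: measurable_indic.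
  split => // eps eps0.
  have [q hq] := peak Xx eps0; exists q.
  apply: (@le_lt_trans _ _ (L (q ^+ 2) - 2 * q.[x] * w x + w x)%:E); last first.
    by rewrite lte_fin.
  apply: int_le.
  - by apply: measurable_funX; apply: measurable_funB => //; exact: measurable_horner.
  - by move=> t; exact: sqr_ge0.
  move=> N; pose F := undup (x :: FN N).
  have FX y : y \in F -> X y.
    by rewrite mem_undup inE => /predU1P[->//|]; exact: FNX.
  apply: (@le_trans _ _ (\sum_(y <- F) ((y == x)%:R - q.[y]) ^+ 2 * w y)).
    apply: ler_sum_subseq => //; first exact: undup_uniq.
      by move=> y yF; rewrite mem_undup inE yF orbT.
    by move=> y _; rewrite mulr_ge0 ?sqr_ge0// ltW.
  have xF : x \in F by rewrite mem_undup mem_head.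
  have := bessel q (undup_uniq _) FX.
  rewrite !(bigD1_seq x xF (undup_uniq _))/= eqxx.
  set S := \sum_(_ <- _ | _) _; set S' := \sum_(_ <- _ | _) _.
  have -> : S' = S.
    by apply: eq_bigr => y /negPf ->; rewrite sub0r sqrrN.
  by rewrite mulr1n !expr2; lra.
split.
- move=> n.
  have mXn : mfun (fun t : R => t ^+ n).
    by have := @measurable_horner R 'X^n; under eq_fun do rewrite hornerXn.
  have int_sqr (p : {poly R}) :
      nu.-integrable setT (fun t => (p.[t] ^+ 2)%:E).
    apply/integrableP; split.
      by apply: measurable_sqrE; exact: measurable_horner.
    under eq_integral do rewrite abse_EFin ger0_norm ?sqr_ge0//.
    by rewrite [ltLHS]nu_sqr ltry.
  split.
    apply: (@le_lt_trans _ _ (sqint nu (fun t => (1%:P : {poly R}).[t]) +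
        sqint nu (fun t => ('X^n : {poly R}).[t]))%E); last first.
      by rewrite !nu_sqr -EFinD ltry.
    rewrite /sqint -ge0_integralD//; first last.
    - by apply: measurable_sqrE; exact: measurable_horner.
    - by move=> t _; rewrite lee_fin sqr_ge0.
    - by apply: measurable_sqrE; exact: measurable_horner.
    - by move=> t _; rewrite lee_fin sqr_ge0.
    apply: ge0_le_integral => //.
    - apply/measurable_EFinP; apply: measurable_funX.
      exact: normr_measurable.
    - by apply: emeasurable_funD; apply: measurable_sqrE; exact: measurable_horner.
    - move=> t _; rewrite -EFinD lee_fin hornerC hornerXn expr1n.
      rewrite -[(t ^+ n) ^+ 2]real_normK ?num_real// normrX.
      by have := sqr_ge0 (`|t| ^+ n - 2^-1); rewrite !expr2; lra.
  pose p1 : {poly R} := 2^-1 *: ('X^n + 1%:P).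
  pose p2 : {poly R} := 2^-1 *: ('X^n - 1%:P).
  transitivity (\int[nu]_t ((p1.[t] ^+ 2)%:E - (p2.[t] ^+ 2)%:E))%E; last first.
    apply: eq_integral => t _; rewrite -EFinB; congr (_%:E).
    by rewrite /p1 /p2 !hornerE; field.
  rewrite integralB_EFin//; [|exact: int_sqr..].
  rewrite -/(sqint nu (fun t => p1.[t])) -/(sqint nu (fun t => p2.[t])).
  rewrite !nu_sqr -EFinB -raddfB/=; congr (_%:E).
  have -> : p1 ^+ 2 - p2 ^+ 2 = 'X^n.
    rewrite /p1 /p2 -!mul_polyC.
    have h : (2^-1)%:P * 2 = 1 :> {poly R} by rewrite -polyC_natr -polyCM mulVf.
    transitivity (((2^-1)%:P * 2) ^+ 2 * 'X^n : {poly R}).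
      by rewrite polyC1; ring.
    by rewrite h expr1n mul1r.
  rewrite /L (@moment_functionalE _ _ n.+1) ?size_polyXn// big_ord_recr/=.
  rewrite big1 ?add0r; last first.
    by move=> i _; rewrite coefXn ltn_eqF ?mul0r// ltn_ord.
  by rewrite coefXn eqxx mul1r.
- move=> f mf ff; apply: poly_approx_closed => // eps eps0.
  pose v k := ((c k)%:num * f (a k) ^+ 2)%:E.
  have v0 k : (0 <= v k)%E by rewrite lee_fin mulr_ge0 ?sqr_ge0.
  have fint : (\sum_(0 <= k <oo) v k < +oo)%E.
    move: ff; rewrite /sqint integral_atomic//; first exact: measurable_funX.
    by move=> t; exact: sqr_ge0.
  have [N hN] : exists N, (\sum_(N <= k <oo) v k < eps%:E)%E.
    have tl := nneseries_tail_cvg fint (fun k _ => v0 k).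
    have /tl[N _ hN] : nbhs (0%E : \bar R) [set y | (y < eps%:E)%E].
      apply: open_nbhs_nbhs; split; first exact: open_ereal_lt_ereal.
      by rewrite /= lte_fin.
    by exists N; apply: hN => /=.
  pose g t := \sum_(x <- FN N) f x * (t == x)%:R.
  have ga : poly_approx nu g.
    rewrite /g; elim: (FN N) (@FNX N) => [_|x F IH FX].
      by under eq_fun => t do rewrite big_nil -(horner0 t); exact: poly_approx_horner.
    under eq_fun do rewrite big_cons.
    apply: poly_approx_lin; first by apply: peak_approx; apply: FX; exact: mem_head.
    by apply: IH => y yF; apply: FX; rewrite inE yF orbT.
  exists g => //.
  have gP k : valid k -> g (a k) = if (k < N)%N then f (a k) else 0.
    move=> vk; have mem_FN : (a k \in FN N) = (k < N)%N.
      apply/mapP/idP => [[j]|kN].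
        by rewrite mem_filter mem_iota/= add0n => /andP[vj jN] /(inj _ _ vk vj) ->.
      by exists k => //; rewrite mem_filter vk mem_iota.
    rewrite -mem_FN /g; case: ifPn => h.
      rewrite (bigD1_seq _ h (FNu N))/= eqxx mulr1 big1 ?addr0// => x.
      by rewrite eq_sym => /negPf ->; rewrite mulr0.
    rewrite big1_seq// => x /andP[_ xF].
    by rewrite (_ : (a k == x) = false) ?mulr0//; apply: contraNF h => /eqP ->.
  apply: le_lt_trans hN; have [mg _] := ga.
  rewrite /sqint integral_atomic//; last 2 first.
  - by apply: measurable_funX; exact: measurable_funB.
  - by move=> t; exact: sqr_ge0.
  rewrite (nneseries_split 0 N); last by move=> k _; rewrite lee_fin mulr_ge0 ?sqr_ge0.
  rewrite add0n big_nat_cond big1 ?add0e; last first.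
    move=> k; rewrite andbT => /andP[_ kN].
    have [/gP|/notvalid ->] := boolP (valid k); last by rewrite mul0r.
    by rewrite kN => ->; rewrite subrr expr0n mulr0.
  apply: lee_nneseries => [k _ _|k _]; first by rewrite lee_fin mulr_ge0 ?sqr_ge0.
  rewrite lee_fin; have [/gP ->|/notvalid ->] := boolP (valid k); last by rewrite !mul0r.
  case: ifPn => _; rewrite ?subr0// subrr expr0n mulr0.
  by rewrite mulr_ge0 ?sqr_ge0.
Qed.

End NExtremalConstruction.

(** * Complex and real approximation *)

Section ComplexL2.
Variables (R : realType) (nu : borel_measure R).
Local Notation Rep f := (fun t => complex.Re (f t)).
Local Notation Imp f := (fun t => complex.Im (f t)).

Lemma L2normE (f : R -> R[i]) : mfun (Rep f) -> mfun (Imp f) ->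
  L2norm nu f = ((sqint nu (Rep f) + sqint nu (Imp f)) `^ 2^-1)%E.
Proof.
move=> mre mim; rewrite /L2norm unlock/=; congr (_ `^ _)%E.
rewrite /sqint -ge0_integralD//; first last.
- exact: measurable_sqrE.
- by move=> t _; rewrite lee_fin sqr_ge0.
- exact: measurable_sqrE.
- by move=> t _; rewrite lee_fin sqr_ge0.
apply: eq_integral => t _.
have n0 : 0 <= Normc.normc (f t) by case: (f t) => x y; exact: sqrtr_ge0.
rewrite ger0_norm// powR_mulrn// -EFinD; congr (_%:E).
by case: (f t) => x y /=; rewrite sqr_sqrtr// addr_ge0 ?sqr_ge0.
Qed.

Lemma L2norm_lt (f : R -> R[i]) (eps : R) : mfun (Rep f) -> mfun (Imp f) ->
  0 < eps ->
  (L2norm nu f < eps%:E)%E =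
  (sqint nu (Rep f) + sqint nu (Imp f) < (eps ^+ 2)%:E)%E.
Proof.
move=> mre mim eps0; rewrite L2normE//.
have := adde_ge0 (sqint_ge0 nu (Rep f)) (sqint_ge0 nu (Imp f)).
case: (_ + _)%E => [r r0| |]//; last first.
  by move=> _; rewrite poweRyr ?invr_eq0// !ltNge !leey.
rewrite poweR_EFin !lte_fin powR12_sqrt//.
by rewrite -[X in _ < X](ger0_norm (ltW eps0)) -sqrtr_sqr ltr_sqrt// exprn_gt0.
Qed.

Lemma L2norm_lty (f : R -> R[i]) : mfun (Rep f) -> mfun (Imp f) ->
  (L2norm nu f < +oo)%E =
  (sqint nu (Rep f) + sqint nu (Imp f) < +oo)%E.
Proof.
move=> mre mim; rewrite L2normE//.
apply/idP/idP => [|h]; last exact: poweR_lty.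
by apply: lty_poweRy; rewrite invr_eq0.
Qed.

Lemma poly_fun_Re_Im (p : {poly R[i]}) : exists p1 p2 : {poly R},
  forall t, poly_fun p t = (p1.[t] +i* p2.[t])%C.
Proof.
rewrite /poly_fun; elim/poly_ind : p => [|p [x y] [p1 [p2 IH]]].
  by exists 0, 0 => t; rewrite !horner0.
exists (p1 * 'X + x%:P), (p2 * 'X + y%:P) => t.
rewrite !hornerMXaddC IH; apply/eqP.
by rewrite eq_complex/= !mulr0 subr0 add0r !eqxx.
Qed.

Lemma poly_fun_of_Re_Im (p1 p2 : {poly R}) : exists p : {poly R[i]},
  forall t, poly_fun p t = (p1.[t] +i* p2.[t])%C.
Proof.
exists (map_poly (real_complex R) p1 + ('i%C)%:P * map_poly (real_complex R) p2) => t.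
rewrite /poly_fun hornerD hornerM hornerC !horner_map/=.
by apply/eqP; rewrite eq_complex/= !mul0r !mul1r subr0 addr0 !add0r !eqxx.
Qed.

Lemma polynomials_dense_of_poly_approx :
  (forall p : {poly R}, (sqint nu (fun t => p.[t]) < +oo)%E) ->
  (forall f, mfun f -> (sqint nu f < +oo)%E -> poly_approx nu f) ->
  polynomials_dense_L2 nu.
Proof.
move=> pfin dense; split => [p|f [mre mim ff] eps eps0].
  have [p1 [p2 pE]] := poly_fun_Re_Im p.
  have m1 : mfun (Rep (poly_fun p)).
    by under eq_fun do rewrite pE/=; exact: measurable_horner.
  have m2 : mfun (Imp (poly_fun p)).
    by under eq_fun do rewrite pE/=; exact: measurable_horner.
  split => //; rewrite L2norm_lty//; apply: lte_add_pinfty.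
    by under [X in sqint _ X]eq_fun do rewrite pE/=; exact: pfin.
  by under [X in sqint _ X]eq_fun do rewrite pE/=; exact: pfin.
move: ff; rewrite L2norm_lty// => ff.
have fre : (sqint nu (Rep f) < +oo)%E.
  by apply: le_lt_trans ff; apply: leeDl; exact: sqint_ge0.
have fim : (sqint nu (Imp f) < +oo)%E.
  by apply: le_lt_trans ff; apply: leeDr; exact: sqint_ge0.
have e2 : 0 < eps ^+ 2 / 2 by rewrite divr_gt0// exprn_gt0.
have [_ /(_ _ e2)[p1 h1]] := dense _ mre fre.
have [_ /(_ _ e2)[p2 h2]] := dense _ mim fim.
have [p pE] := poly_fun_of_Re_Im p1 p2; exists p.
have Er : (fun t => complex.Re (f t - poly_fun p t)) = (fun t => complex.Re (f t) - p1.[t]).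
  by apply/funext => t; rewrite pE; case: (f t).
have Ei : (fun t => complex.Im (f t - poly_fun p t)) = (fun t => complex.Im (f t) - p2.[t]).
  by apply/funext => t; rewrite pE; case: (f t).
rewrite L2norm_lt//; last 2 first.
- by rewrite Er; apply: measurable_funB => //; exact: measurable_horner.
- by rewrite Ei; apply: measurable_funB => //; exact: measurable_horner.
rewrite Er Ei.
have -> : (eps ^+ 2)%:E = ((eps ^+ 2 / 2)%:E + (eps ^+ 2 / 2)%:E)%E.
  by rewrite -EFinD; congr (_%:E); field.
exact: lteD.
Qed.

Lemma poly_approx_of_polynomials_dense : polynomials_dense_L2 nu ->
  forall f, mfun f -> (sqint nu f < +oo)%E -> poly_approx nu f.
Proof.
move=> [_ dense] f mf ff; split => // eps eps0.
pose F t : R[i] := (f t +i* 0)%C.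
have im0 : sqint nu (fun=> 0) = 0%E.
  by rewrite /sqint; under eq_integral do rewrite expr0n/=; rewrite integral0.
have FL2 : complex_L2 nu F.
  split => //.
  by rewrite L2norm_lty//= im0 adde0.
have s0 : 0 < Num.sqrt eps by rewrite sqrtr_gt0.
have [p hp] := dense F FL2 _ s0.
have [p1 [p2 pE]] := poly_fun_Re_Im p; exists p1.
have Er : (fun t => complex.Re (F t - poly_fun p t)) = (fun t => f t - p1.[t]).
  by apply/funext => t; rewrite pE.
have Ei : (fun t => complex.Im (F t - poly_fun p t)) = (fun t => 0 - p2.[t]).
  by apply/funext => t; rewrite pE.
move: hp; rewrite L2norm_lt//; last 2 first.
- by rewrite Er; apply: measurable_funB => //; exact: measurable_horner.
- rewrite Ei; apply: measurable_funB; first exact: measurable_cst.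
  exact: measurable_horner.
rewrite Er Ei sqr_sqrtr ?ltW//; apply: le_lt_trans.
by apply: leeDl; exact: sqint_ge0.
Qed.

End ComplexL2.

(** * Existence of N-extremal measures *)

Section IndeterminateSequence.
Variables (R : realType) (gamma : nat -> R).
Hypothesis indet : H_indeterminate gamma.
Let L : {scalar {poly R}} := moment_functional gamma.

Lemma indeterminate_kernel : [/\ forall p : {poly R}, p != 0 -> 0 < L (p ^+ 2) &
  exists (P : nat -> {poly R}) (M : R -> R), [/\ orthonormal_polys L P,
    forall (r : R) n (w : R), `|w| <= r -> Kdiag P n w <= M r &
    forall (r : R) n (w w' : R), `|w| <= r -> `|w'| <= r ->
      \sum_(k < n) ((P k).[w] - (P k).[w']) ^+ 2 <= M r * (w - w') ^+ 2]].
Proof.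
have [C rem_bounded] := rem_bounded_of_indeterminate indet.
have [mu [_ [mu_rep _ _]]] := indet.
have L_sqr_ge0 : forall p : {poly R}, 0 <= L (p ^+ 2) := rep_L_sqr_ge0 mu_rep.
have L1_pos : 0 < L 1.
  have [_ _ r1] : [/\ quo (1 : {poly R}) = 0, rem1 (1 : {poly R}) = 0 &
      rem0 (1 : {poly R}) = 1].
    by apply: quadr_divE_uniq; rewrite mul0r scale0r !add0r.
  have L1 : 0 <= L 1 by have := L_sqr_ge0 1; rewrite expr1n.
  rewrite lt_neqAle L1 andbT; apply: contraTneq (rem_bounded 1) => L10.
  rewrite expr1n -/L -L10 mulr0 r1 expr1n -ltNge.
  by rewrite ltr_pwDl ?sqr_ge0.
have L_pos := L_pos_of_rem_bounded L_sqr_ge0 rem_bounded.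
have [P PP] := exists_orthonormal_polys L_pos.
split => //; exists P, (fun r => Num.max (Kbound L C r) (Lipbound L C r)); split => //.
  move=> r n w wr; rewrite le_max; apply/orP; left.
  exact: (Kdiag_bounded L_sqr_ge0 L1_pos rem_bounded PP).
move=> r n w w' wr w'r.
apply: (le_trans (kernel_Lipschitz L_sqr_ge0 L1_pos rem_bounded PP n wr w'r)).
by rewrite ler_wpM2r ?sqr_ge0// le_max lexx orbT.
Qed.

Lemma evaluation_bounded x : exists C, forall p : {poly R},
  p.[x] ^+ 2 <= C * L (p ^+ 2).
Proof.
have [L_pos [P [M [PP Kle _]]]] := indeterminate_kernel.
exists (M `|x|) => p.
apply: (le_trans (sqr_horner_le L_pos PP x (leqnn (size p)))).
by rewrite ler_wpM2r ?L_sqr_ge0// Kle.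
Qed.

(** The limit nodes of the Gauss quadratures, with masses [1 / Kdiag_lim P x].
    Countability comes from the finite lists of [limit_nodes_exhaust]. *)
Lemma exists_N_extremal : exists nu : borel_measure R, N_extremal gamma nu.
Proof.
have [L_pos [P [M [PP Kle Klip]]]] := indeterminate_kernel.
have [U [UF U_oo]] := ultraFilterLemma (_ : ProperFilter (\oo : set_system nat)).
have /choice[s sP] := orthonormal_real_roots L_pos PP.
have /choice[F FP] := fun k : nat =>
  limit_nodes_exhaust L_pos PP Kle Klip UF U_oo sP (ltr0Sn R k).
pose X := \bigcup_k [set x | x \in F k].
have XF k x : x \in F k -> X x by move=> xF; exists k.
have Xlim x : X x -> limit_node U s x.
  by move=> [k _ xF]; have [_ + _] := FP k; apply.
have Kinf0 := Kdiag_lim_gt0 L_pos PP Kle.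
have [] := @exists_N_extremal_atomic R gamma (fun x => (Kdiag_lim P x)^-1) X.
- by move=> x; rewrite invr_gt0.
- apply: bigcup_countable => // k _; apply: finite_set_countable.
  exact: finite_seq.
- move=> l q ul lX.
  apply: (limit_nodes_bessel L_pos PP Kle Klip UF U_oo sP q ul) => x xl.
  exact/Xlim/lX.
- move=> q eps eps0.
  have Xq0 : 0 <= L (('X * q) ^+ 2) by exact: L_sqr_ge0.
  pose k := Num.bound (L (('X * q) ^+ 2) / eps).
  have [uF FX hF] := FP k; exists (F k); split => //; first exact: XF.
  apply: (le_trans (hF q)); rewrite lerD2l ler_pdivrMr ?exprn_gt0//.
  have hk : L (('X * q) ^+ 2) / eps < k%:R by apply: archi_boundP; rewrite divr_ge0// ltW.
  rewrite [leRHS]mulrC -ler_pdivrMr//; apply: (le_trans (ltW hk)).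
  rewrite (@le_trans _ _ k.+1%:R)// ?ler_nat//.
  by rewrite expr2 ler_peMr// ler1n.
- move=> x eps Xx eps0; set a := (Kdiag_lim P x)^-1.
  have a0 : 0 < a by rewrite invr_gt0.
  have e0 : 0 < eps / a ^+ 2 by rewrite divr_gt0// exprn_gt0.
  have := Kdiag_cvg Kle (x := x) => /cvgrPdist_lt /(_ _ e0)[N _ /(_ N (leqnn N))].
  move=> /(le_lt_trans (ler_norm _)); rewrite ltr_pdivlMr ?exprn_gt0// => hN.
  (* The extremal polynomials of the Christoffel function peak at [x]. *)
  exists (a *: Kpoly P N x).
  rewrite (L_sqrZ L) (L_sqr_Kpoly PP) hornerZ horner_Kpoly_diag.
  apply: le_lt_trans hN; rewrite le_eqVlt; apply/orP; left; apply/eqP.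
  rewrite -/a /a; field; exact: lt0r_neq0.
- move=> nu [nu_rep nu_dense]; exists nu; split => //.
  apply: polynomials_dense_of_poly_approx => // p.
  by rewrite (sqint_horner nu_rep) ltry.
Qed.

End IndeterminateSequence.

(** * Comparison of a semibounded with an N-extremal measure *)

Section SemiboundedComparison.
Variables (R : realType) (gamma : nat -> R).
Let L : {scalar {poly R}} := moment_functional gamma.
Let LD (p q : {poly R}) : L (p + q) = L p + L q. Proof. exact: linearD. Qed.
Let LN (p : {poly R}) : L (- p) = - L p. Proof. exact: linearN. Qed.
Let LZ c (p : {poly R}) : L (c *: p) = c * L p. Proof. exact: linearZ. Qed.

Lemma L_ge0_of_nonneg_ae (nu : borel_measure R) (N : set (measurableTypeR R))
    (p : {poly R}) : H_representing gamma nu -> measurable N -> nu N = 0%E ->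
  (forall t, ~ N t -> 0 <= p.[t]) -> 0 <= L p.
Proof.
move=> nu_rep mN N0 p0; rewrite -lee_fin -(integral_horner nu_rep).
rewrite (negligible_integral _ _ _ N0)//; last exact: (integrable_horner nu_rep).
by apply: integral_ge0 => t [_ Nt]; rewrite lee_fin p0.
Qed.

(** Integration of an inequality between nonnegative functions. Polynomials and
    squares are kept apart, since the former have integrals known from [L]. *)
Lemma le_integral_mixed (mu : borel_measure R) (p1 p2 : {poly R}) (f e : R -> R)
    (c1 c2 c3 : R) : H_representing gamma mu -> mfun f -> mfun e ->
  0 <= c1 -> 0 <= c2 -> 0 <= c3 ->
  (forall t, 0 <= p1.[t]) -> (forall t, 0 <= p2.[t]) ->
  (forall t, p1.[t] + c1 * f t ^+ 2 <= p2.[t] + (c2 * e t ^+ 2 + c3 * f t ^+ 2)) ->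
  ((L p1)%:E + c1%:E * sqint mu f <=
   (L p2)%:E + (c2%:E * sqint mu e + c3%:E * sqint mu f))%E.
Proof.
move=> mu_rep mf me c10 c20 c30 p10 p20 h.
have mp (p : {poly R}) : measurable_fun [set: measurableTypeR R] (fun t => p.[t]%:E).
  by apply/measurable_EFinP; exact: measurable_horner.
have msq c (g : R -> R) : mfun g ->
    measurable_fun [set: measurableTypeR R] (fun t => (c%:E * (g t ^+ 2)%:E)%E).
  by move=> mg; apply: measurable_funeM; exact: measurable_sqrE.
have sq0 c (g : R -> R) t : 0 <= c -> (0 <= c%:E * (g t ^+ 2)%:E)%E.
  by move=> c0; rewrite -EFinM lee_fin mulr_ge0 ?sqr_ge0.
have intZ c (g : R -> R) : 0 <= c -> mfun g ->
    (c%:E * sqint mu g = \int[mu]_t (c%:E * (g t ^+ 2)%:E))%E.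
  move=> c0 mg; rewrite ge0_integralZl_EFin//.
    by move=> t _; rewrite lee_fin sqr_ge0.
  exact: measurable_sqrE.
rewrite -!(integral_horner mu_rep) !intZ//.
rewrite -[in leRHS]ge0_integralD//; try by [move=> t _; exact: sq0|exact: msq].
rewrite -!ge0_integralD//; try by
  [move=> t _; exact: sq0|exact: msq|move=> t _; rewrite lee_fin
  |move=> t _; apply: adde_ge0; exact: sq0|apply: emeasurable_funD; exact: msq].
apply: ge0_le_integral => //.
- by move=> t _; apply: adde_ge0; [rewrite lee_fin|exact: sq0].
- by apply: emeasurable_funD => //; exact: msq.
- by apply: emeasurable_funD => //; apply: emeasurable_funD; exact: msq.
- by move=> t _; rewrite -!EFinM -!EFinD lee_fin.
Qed.

Lemma exists_unit_orthogonal (u v : R) : exists al be : R,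
  al ^+ 2 + be ^+ 2 = 1 /\ al * u + be * v = 0.
Proof.
have [uv0|uv0] := eqVneq (u ^+ 2 + v ^+ 2) 0.
  have u0 : u = 0.
    by apply/eqP; rewrite -sqrf_eq0 eq_le sqr_ge0 andbT; have := sqr_ge0 v; lra.
  have v0 : v = 0.
    by apply/eqP; rewrite -sqrf_eq0 eq_le sqr_ge0 andbT; have := sqr_ge0 u; lra.
  by exists 1, 0; rewrite u0 v0 expr1n expr0n mulr0 mul0r !addr0.
set n := Num.sqrt (u ^+ 2 + v ^+ 2).
have n2 : n ^+ 2 = u ^+ 2 + v ^+ 2 by rewrite sqr_sqrtr// addr_ge0 ?sqr_ge0.
have n0 : n != 0 by rewrite -sqrf_eq0 n2.
exists (v / n), (- u / n); split; last by field.
transitivity ((u ^+ 2 + v ^+ 2) / n ^+ 2); first by field.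
by rewrite n2 mulfV.
Qed.

(** The sign [sg] treats both half-lines at once: [S] is [sg (t - x0)], which is
    at least [d] almost everywhere for [nu] and at most [- d'] on [A1] and [A2].
    In L^2 of [mu], polynomials [q1] and [q2] approximate [S] times the
    indicator functions. A combination of norm one of [q1] and [q2] vanishes at
    [x0], hence is [S * r]; it approximates [S f] with [f] the same combination
    of the indicator functions. The estimate [S_ge], proved with [nu], bounds
    the norm of [r], so that [\int S r ^ 2] is close to [\int S f ^ 2], which is
    at most [- d' * k]. But [\int S r ^ 2] is nonnegative, again by [nu]. *)
Lemma N_extremal_negative_part (nu mu : borel_measure R) (sg x0 d d' B : R)
    (N A1 A2 : set (measurableTypeR R)) :
  H_representing gamma nu -> N_extremal gamma mu ->
  sg ^+ 2 = 1 -> 0 < d -> 0 < d' ->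
  measurable N -> nu N = 0%E -> (forall t, ~ N t -> d <= sg * (t - x0)) ->
  measurable A1 -> measurable A2 -> (forall t, A1 t -> ~ A2 t) ->
  (forall t, A1 t \/ A2 t -> - B <= sg * (t - x0) <= - d') ->
  (0 < mu A1)%E -> (0 < mu A2)%E -> False.
Proof.
move=> nu_rep [_ mu_rep mu_dense] sg2 d0 d'0 mN N0 Nd mA1 mA2 A12 AB pA1 pA2.
have [S [SX SE]] : exists S : {poly R},
    S = sg *: ('X - x0%:P) /\ forall t, S.[t] = sg * (t - x0).
  by eexists; split => // t; rewrite hornerZ hornerXsubC.
have S_ge0 (r : {poly R}) : 0 <= L (S * r ^+ 2).
  apply: (L_ge0_of_nonneg_ae nu_rep mN N0) => t /Nd h.
  by rewrite hornerM horner_exp SE mulr_ge0 ?sqr_ge0// (le_trans _ h)// ltW.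
have S_ge (r : {poly R}) : d ^+ 2 * L (r ^+ 2) <= L ((S * r) ^+ 2).
  rewrite -subr_ge0.
  have -> : L ((S * r) ^+ 2) - d ^+ 2 * L (r ^+ 2) =
      L ((S * r) ^+ 2 - d ^+ 2 *: r ^+ 2) by rewrite LD LN LZ.
  apply: (L_ge0_of_nonneg_ae nu_rep mN N0) => t /Nd h.
  rewrite hornerD hornerN hornerZ !horner_exp hornerM exprMn -mulrBl SE.
  have h0 : 0 <= sg * (t - x0) by exact: le_trans (ltW d0) h.
  by rewrite mulr_ge0 ?sqr_ge0// subr_ge0 lerXn2r ?nnegrE// ltW.
pose m1 := fine (mu A1); pose m2 := fine (mu A2).
have m1E : mu A1 = m1%:E.
  by rewrite fineK// ge0_fin_numE//; exact: (rep_finite mu_rep).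
have m2E : mu A2 = m2%:E.
  by rewrite fineK// ge0_fin_numE//; exact: (rep_finite mu_rep).
have m10 : 0 < m1 by rewrite -lte_fin -m1E.
have m20 : 0 < m2 by rewrite -lte_fin -m2E.
pose k := Num.min m1 m2; have k0 : 0 < k by rewrite lt_min m10.
pose a1 t : R := \1_A1 t; pose a2 t : R := \1_A2 t.
have ma1 : mfun a1 by exact: measurable_indic.
have ma2 : mfun a2 by exact: measurable_indic.
have a12 t : [/\ a1 t ^+ 2 = a1 t, a2 t ^+ 2 = a2 t & a1 t * a2 t = 0].
  rewrite /a1 /a2 !indicE.
  have [A1t|nA1t] := pselect (A1 t).
    by rewrite (mem_set A1t) (memNset (A12 t A1t)) !expr1n !expr0n mulr0.
  rewrite (memNset nA1t) mul0r expr0n.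
  by have [A2t|nA2t] := pselect (A2 t);
    rewrite ?(mem_set A2t) ?(memNset nA2t) ?expr1n ?expr0n.
pose f al be t : R := al * a1 t + be * a2 t.
have mf al be : mfun (f al be).
  by apply: measurable_funD; apply: measurable_funM.
have fsqr al be t : f al be t ^+ 2 = al ^+ 2 * a1 t ^+ 2 + be ^+ 2 * a2 t ^+ 2.
  by have [_ _ h] := a12 t; rewrite /f -[RHS]addr0 -(mulr0 (2 * al * be)) -h; ring.
have sq_a1 : sqint mu a1 = m1%:E.
  rewrite -m1E; transitivity (\int[mu]_t (\1_A1 t : R)%:E)%E; last first.
    by rewrite integral_indic// setIT.
  by apply: eq_integral => t _; have [-> _ _] := a12 t.
have sq_a2 : sqint mu a2 = m2%:E.
  rewrite -m2E; transitivity (\int[mu]_t (\1_A2 t : R)%:E)%E; last first.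
    by rewrite integral_indic// setIT.
  by apply: eq_integral => t _; have [_ -> _] := a12 t.
have sq_f al be : sqint mu (f al be) = (al ^+ 2 * m1 + be ^+ 2 * m2)%:E.
  rewrite /sqint; under eq_integral do rewrite fsqr EFinD !EFinM.
  rewrite ge0_integralD//; first last.
  - by apply: measurable_funeM; exact: measurable_sqrE.
  - by move=> t _; rewrite -EFinM lee_fin mulr_ge0 ?sqr_ge0.
  - by apply: measurable_funeM; exact: measurable_sqrE.
  - by move=> t _; rewrite -EFinM lee_fin mulr_ge0 ?sqr_ge0.
  rewrite !ge0_integralZl_EFin ?sqr_ge0//; try by
    [exact: measurable_sqrE|move=> t _; rewrite lee_fin sqr_ge0].
  by rewrite -/(sqint mu a1) -/(sqint mu a2) sq_a1 sq_a2 -!EFinM -EFinD.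
have f_supp al be t : f al be t = 0 \/ (- B <= S.[t] <= - d').
  rewrite SE /f /a1 /a2 !indicE.
  have [A1t|nA1t] := pselect (A1 t); first by right; apply: AB; left.
  have [A2t|nA2t] := pselect (A2 t); first by right; apply: AB; right.
  by left; rewrite (memNset nA1t) (memNset nA2t) !mulr0 addr0.
have SfB al be t : (S.[t] * f al be t) ^+ 2 <= B ^+ 2 * f al be t ^+ 2.
  have [->|/andP[h1 h2]] := f_supp al be t; first by rewrite mulr0 expr0n mulr0.
  rewrite exprMn ler_wpM2r ?sqr_ge0// -sqrrN lerXn2r ?nnegrE//; lra.
have Sfd al be t : S.[t] * f al be t ^+ 2 <= - d' * f al be t ^+ 2.
  have [->|/andP[h1 h2]] := f_supp al be t; first by rewrite expr0n !mulr0.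
  by rewrite ler_wpM2r ?sqr_ge0.
have mS : mfun (fun t => S.[t]) by exact: measurable_horner.
have mSf al be : mfun (fun t => S.[t] * f al be t) by exact: measurable_funM.
have approx_S g : mfun g -> (forall t, (S.[t] * g t) ^+ 2 <= B ^+ 2 * g t ^+ 2) ->
    (sqint mu g < +oo)%E -> poly_approx mu (fun t => S.[t] * g t).
  move=> mg hg fg; apply: (poly_approx_of_polynomials_dense mu_dense).
    exact: measurable_funM.
  apply: (@le_lt_trans _ _ ((B ^+ 2)%:E * sqint mu g)%E).
    by apply: sqint_le1 => //; [exact: sqr_ge0|exact: measurable_funM].
  by rewrite lte_mul_pinfty// ?lee_fin ?sqr_ge0.
have ap1 : poly_approx mu (fun t => S.[t] * a1 t).
  apply: approx_S => //; last by rewrite sq_a1 ltry.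
  by move=> t; have := SfB 1 0 t; rewrite /f mul1r mul0r addr0.
have ap2 : poly_approx mu (fun t => S.[t] * a2 t).
  apply: approx_S => //; last by rewrite sq_a2 ltry.
  by move=> t; have := SfB 0 1 t; rewrite /f mul1r mul0r add0r.
(* [T] bounds the squared norm of [f], and [W] that of [r] and of [f] together;
   [th] and [eps] then keep all error terms below the gap [d' * k]. *)
pose T := m1 + m2; have T0 : 0 < T by rewrite addr_gt0.
pose W := (8 + 2 * B ^+ 2 * T) / d ^+ 2 + T.
have W0 : 0 < W.
  have B2 : 0 <= 2 * B ^+ 2 by apply: mulr_ge0 => //; exact: sqr_ge0.
  have h := mulr_ge0 B2 (ltW T0).
  by rewrite ltr_pwDr// divr_ge0 ?sqr_ge0// addr_ge0.
pose th := d' * k / (4 * W).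
have th0 : 0 < th by rewrite divr_gt0 ?mulr_gt0.
pose eps := Num.min 1 (th * (d' * k) / 4).
have eps0 : 0 < eps.
  by rewrite lt_min ltr01/= divr_gt0//; apply: mulr_gt0 => //; exact: mulr_gt0.
have [_ /(_ _ eps0)[q1 hq1]] := ap1; have [_ /(_ _ eps0)[q2 hq2]] := ap2.
have [al [be [ab1 ab0]]] := exists_unit_orthogonal q1.[x0] q2.[x0].
have : root (al *: q1 + be *: q2) x0 by rewrite /root !hornerE ab0.
move=> /factor_theorem[h hE].
pose r := sg *: h.
have Sr : S * r = al *: q1 + be *: q2.
  by rewrite hE SX /r -scalerAl -scalerAr scalerA -expr2 sg2 scale1r mulrC.
pose e t : R := S.[t] * f al be t - (S * r).[t].
have me : mfun e by apply: measurable_funB => //; exact: measurable_horner.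
have alb : al ^+ 2 <= 1 by have := sqr_ge0 be; lra.
have beb : be ^+ 2 <= 1 by have := sqr_ge0 al; lra.
have sq_e : (sqint mu e <= (4 * eps)%:E)%E.
  apply: (@le_trans _ _ (2%:E * sqint mu (fun t => (S.[t] * a1 t - q1.[t])%R) +
     2%:E * sqint mu (fun t => (S.[t] * a2 t - q2.[t])%R))%E).
    have mp g (q : {poly R}) : mfun g -> mfun (fun t => S.[t] * g t - q.[t]).
      move=> mg; apply: measurable_funB; last exact: measurable_horner.
      exact: measurable_funM.
    apply: sqint_le => //; [exact: mp|exact: mp|move=> t].
    rewrite /e Sr /f hornerD !hornerZ.
    set u := S.[t] * a1 t - q1.[t]; set v := S.[t] * a2 t - q2.[t].
    have -> : S.[t] * (al * a1 t + be * a2 t) - (al * q1.[t] + be * q2.[t]) =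
      al * u + be * v by rewrite /u /v; ring.
    have h1 := ler_wpM2r (sqr_ge0 u) alb; have h2 := ler_wpM2r (sqr_ge0 v) beb.
    by have := sqr_ge0 (al * u - be * v); lra.
  have -> : (4 * eps)%:E = (2%:E * eps%:E + 2%:E * eps%:E)%E.
    by rewrite -!EFinM -EFinD; congr (_%:E); ring.
  by apply: leeD; apply: lee_wpmul2l; rewrite ?lee_fin//; exact: ltW.
pose F := al ^+ 2 * m1 + be ^+ 2 * m2.
have kF : k <= F.
  have k1 : k <= m1 by rewrite ge_min lexx.
  have k2 : k <= m2 by rewrite ge_min lexx orbT.
  have := ler_wpM2l (sqr_ge0 al) k1; have := ler_wpM2l (sqr_ge0 be) k2.
  have : (al ^+ 2 + be ^+ 2) * k = k by rewrite ab1 mul1r.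
  rewrite /F; lra.
have FT : F <= T.
  by have := ler_wpM2r (ltW m10) alb; have := ler_wpM2r (ltW m20) beb; rewrite /F /T; lra.
have [E EE] : exists E, sqint mu e = E%:E.
  exists (fine (sqint mu e)); rewrite fineK// ge0_fin_numE ?sqint_ge0//.
  by apply: (le_lt_trans sq_e); rewrite ltry.
have E4 : E <= 4 * eps by rewrite -lee_fin -EE.
have LSr : L ((S * r) ^+ 2) <= 2 * E + 2 * B ^+ 2 * F.
  have B2 : 0 <= 2 * B ^+ 2 by apply: mulr_ge0 => //; exact: sqr_ge0.
  have := @sqint_le _ mu (fun t => (S * r).[t]) e (f al be) 2 (2 * B ^+ 2) _ B2
    (measurable_horner _) me (mf al be).
  rewrite (sqint_horner mu_rep) EE sq_f -!EFinM -EFinD lee_fin; apply => // t.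
  have := SfB al be t; have := sqr_ge0 (2 * (S.[t] * f al be t) - (S * r).[t]).
  by rewrite /e; set u := S.[t] * f al be t; set v := (S * r).[t]; lra.
have eps1 : eps <= 1 by rewrite ge_min lexx.
have BF : B ^+ 2 * F <= B ^+ 2 * T by rewrite ler_wpM2l ?sqr_ge0.
have Lr : L (r ^+ 2) <= (8 + 2 * B ^+ 2 * T) / d ^+ 2.
  rewrite ler_pdivlMr ?exprn_gt0// mulrC.
  by apply: (le_trans (S_ge r)); apply: (le_trans LSr); lra.
have main : L (S * r ^+ 2) + d' * F <= (2 * th)^-1 * E + th * (L (r ^+ 2) + F).
  (* Adding [c] to both sides makes the integrands nonnegative. *)
  pose c : {poly R} := (S ^+ 2 + 1%:P) * r ^+ 2.
  have th2 : 0 <= (2 * th)^-1 by rewrite invr_ge0 mulr_ge0// ltW.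
  have := @le_integral_mixed mu (c + S * r ^+ 2) (c + th *: r ^+ 2) (f al be) e
    d' (2 * th)^-1 th mu_rep (mf al be) me (ltW d'0) th2 (ltW th0).
  rewrite EE sq_f -!EFinM -!EFinD lee_fin !LD LZ.
  move=> main; rewrite -(lerD2l (L c)) addrA; apply: (le_trans (main _ _ _)).
  - move=> t; rewrite /c !(hornerD, hornerM, horner_exp, hornerC).
    have -> : (S.[t] ^+ 2 + 1) * r.[t] ^+ 2 + S.[t] * r.[t] ^+ 2 =
      ((S.[t] + 2^-1) ^+ 2 + 3 / 4) * r.[t] ^+ 2 by field.
    by rewrite mulr_ge0 ?sqr_ge0// addr_ge0 ?sqr_ge0.
  - move=> t; rewrite /c hornerD (hornerZ th) !(hornerM, hornerD, horner_exp, hornerC).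
    apply: addr_ge0; apply: mulr_ge0; rewrite ?sqr_ge0//; last exact: ltW.
    by rewrite addr_ge0 ?sqr_ge0.
  - move=> t; rewrite !hornerD -!addrA lerD2l hornerM (hornerZ th) !horner_exp.
    have h1 := Sfd al be t.
    have h2 := mulr_ge0 th2 (sqr_ge0 (e t + th * (r.[t] + f al be t))).
    have h3 := mulr_ge0 (ltW th0) (sqr_ge0 (r.[t] - f al be t)).
    have eE : e t = S.[t] * (f al be t - r.[t]) by rewrite /e hornerM; ring.
    have h4 : (2 * th)^-1 * (e t + th * (r.[t] + f al be t)) ^+ 2 =
      (2 * th)^-1 * e t ^+ 2 + S.[t] * f al be t ^+ 2 - S.[t] * r.[t] ^+ 2
      + th / 2 * (r.[t] + f al be t) ^+ 2.
      by rewrite eE; field; rewrite gt_eqF.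
    move: h1 h2 h3; rewrite h4.
    set a := S.[t] * f al be t ^+ 2; set b := S.[t] * r.[t] ^+ 2.
    set z := (2 * th)^-1 * _; lra.
  - by rewrite le_eqVlt; apply/orP; left; apply/eqP; rewrite /F; ring.
have LrF : th * (L (r ^+ 2) + F) <= d' * k / 4.
  apply: (@le_trans _ _ (th * W)).
    by rewrite ler_pM2l// lerD.
  by rewrite /th le_eqVlt; apply/orP; left; apply/eqP; field; rewrite gt_eqF.
have Eth : (2 * th)^-1 * E <= d' * k / 2.
  have th2 : 0 < 2 * th by apply: mulr_gt0.
  rewrite ler_pdivrMl//; apply: (le_trans E4).
  have : eps <= th * (d' * k) / 4 by rewrite ge_min lexx orbT.
  lra.
have d'k : 0 < d' * k by rewrite mulr_gt0.
have := S_ge0 r; have := ler_wpM2l (ltW d'0) kF; lra.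
Qed.

End SemiboundedComparison.

(** * Supports *)

Section Supports.
Variables (R : realType) (nu : borel_measure R).

(** The line has a countable base, so the complement of the support is covered
    by countably many null intervals with rational endpoints. *)
Lemma null_of_disjoint_supp (A : set R) :
  measurable (A : set (measurableTypeR R)) -> (forall x, A x -> ~ supp nu x) ->
  nu A = 0%E.
Proof.
move=> mA Asupp; apply: measure_negligible => //.
pose I (k : nat) : set (measurableTypeR R) :=
  if unpickle k is Some (q, r) then
    (if nu `](ratr q : R), (ratr r : R)[%classic == 0%E
     then `](ratr q : R), (ratr r : R)[%classic else set0)
  else set0.
have Inegl k : nu.-negligible (I k).
  rewrite /I; case: unpickle => [[q r]|]; last exact: negligible_set0.
  case: eqP => [h|_]; last exact: negligible_set0.
  by apply/negligibleP => //; exact: measurable_itv.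
apply: negligibleS (negligible_bigcup Inegl) => x /Asupp xsupp.
have [U [oU Ux U0]] : exists U : set R, [/\ open U, U x & nu U = 0%E].
  apply: contrapT => h; apply: xsupp => U oU Ux.
  rewrite lt_neqAle measure_ge0 andbT eq_sym; apply/eqP => U0.
  by apply: h; exists U.
have : nbhs x U by exact: open_nbhs_nbhs.
move=> /nbhs_ballP[e /= e0 xeU].
have [q] : exists q : rat, ratr q \in `]x - e, x[.
  by apply: rat_in_itvoo; rewrite ltrBlDr ltrDl.
have [r] : exists q : rat, ratr q \in `]x, x + e[.
  by apply: rat_in_itvoo; rewrite ltrDl.
rewrite !in_itv/= => /andP[xr re] /andP[qe qx].
have sub : `](ratr q : R), (ratr r : R)[%classic `<=` U.
  move=> y /=; rewrite in_itv/= => /andP[qy yr]; apply: xeU.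
  by rewrite /ball/= ltr_distlC; apply/andP; split; lra.
have I0 : nu `](ratr q : R), (ratr r : R)[%classic = 0%E.
  apply/eqP; rewrite eq_le measure_ge0 andbT -U0; apply: le_measure => //.
  - by rewrite inE; exact: measurable_itv.
  - by rewrite inE; exact: open_measurable.
have IE : I (pickle (q, r)) = `](ratr q : R), (ratr r : R)[%classic.
  by rewrite /I pickleK I0 eqxx.
by exists (pickle (q, r)); [|rewrite IE /= in_itv/= qx xr].
Qed.

Lemma supp_ge_of_inf : (-oo < inf_supp nu)%E ->
  exists a : R, forall x, supp nu x -> a <= x.
Proof.
move=> h; have lb x : supp nu x -> (inf_supp nu <= x%:E)%E.
  by move=> sx; apply: ereal_inf_lbound; exists x.
case: (inf_supp nu) h lb => [r| |]// _ lb; first by exists r => x /lb.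
by exists 0 => x /lb; rewrite leye_eq.
Qed.

Lemma supp_le_of_sup : (sup_supp nu < +oo)%E ->
  exists b : R, forall x, supp nu x -> x <= b.
Proof.
move=> h; have ub x : supp nu x -> (x%:E <= sup_supp nu)%E.
  by move=> sx; apply: ereal_sup_ubound; exists x.
case: (sup_supp nu) h ub => [r| |]// _ ub; first by exists r => x /ub.
by exists 0 => x /ub; rewrite leeNy_eq.
Qed.

Lemma supp_lt_of_inf (m : R) : inf_supp nu = -oo%E ->
  exists2 x, supp nu x & x < m.
Proof.
move=> h; have : (inf_supp nu < m%:E)%E by rewrite h ltNyr.
by move=> /ereal_inf_lt[_ [x sx <-]]; rewrite lte_fin; exists x.
Qed.

Lemma supp_gt_of_sup (m : R) : sup_supp nu = +oo%E ->
  exists2 x, supp nu x & m < x.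
Proof.
move=> h; have : (m%:E < sup_supp nu)%E by rewrite h ltry.
by move=> /ereal_sup_gt[_ [x sx <-]]; rewrite lte_fin; exists x.
Qed.

End Supports.

Section NExtremalSupports.
Variables (R : realType) (gamma : nat -> R).

(** Apply [N_extremal_negative_part] with [S = sg t - (a - 1)], which is at least
    1 on the support of [nu], and with unit balls around two points of the
    support of [mu] on which [sg t] is far below [a]. *)
Lemma semibounded_transfer (nu mu : borel_measure R) (sg a : R) :
  sg ^+ 2 = 1 -> H_representing gamma nu -> N_extremal gamma mu ->
  (forall x, supp nu x -> a <= sg * x) ->
  (forall m, exists2 x, supp mu x & sg * x < m) -> False.
Proof.
move=> sg2 nu_rep mu_ext nu_supp mu_supp.
have [p1 sp1 p1a] := mu_supp (a - 3).
have [p2 sp2 p2p1] := mu_supp (sg * p1 - 2).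
have sg1 : `|sg| = 1.
  by apply/eqP; rewrite -(@eqrXn2 _ 2)// real_normK ?num_real// sg2 expr1n.
pose A (p : R) : set (measurableTypeR R) := ball p 1.
have oA p : open (A p : set R) by exact: ball_open.
have mA p : measurable (A p) by exact: open_measurable.
have pA p : supp mu p -> (0 < mu (A p))%E.
  by move=> sp; apply: sp => //; exact: ballxx.
have AE p t : A p t -> `|sg * t - sg * p| < 1.
  by rewrite /A /ball/= -mulrBr normrM sg1 mul1r distrC.
pose x0 := sg * (a - 1).
have x0E t : sg * (t - x0) = sg * t - (a - 1).
  by rewrite /x0 mulrBr mulrA -expr2 sg2 mul1r.
pose N : set (measurableTypeR R) := [set t | sg * t < a].
have mN : measurable N.
  rewrite (_ : N = (fun t => (sg *: 'X).[t]) @^-1` `]-oo, a[%classic).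
    rewrite -[X in measurable X]setTI; apply: measurable_horner => //.
  by apply/seteqP; split => t /=; rewrite in_itv/= hornerZ hornerX.
apply: (@N_extremal_negative_part R gamma nu mu sg x0 1 1
  (a - 1 - sg * p2 + 1) N (A p1) (A p2)) => //.
- apply: null_of_disjoint_supp => // x Nx /nu_supp.
  by rewrite leNgt => /negP; apply.
- by move=> t /= /negP; rewrite -leNgt x0E; lra.
- by move=> t /AE + /AE; rewrite !ltr_distl => /andP[h1 h2] /andP[h3 h4]; lra.
- move=> t; rewrite x0E.
  by case=> /AE; rewrite ltr_distl => /andP[h1 h2]; apply/andP; split; lra.
- exact: pA.
- exact: pA.
Qed.

(** If the support lay in [[- M, M]], the polynomials [(X / (M + 1)) ^ n] would
    tend to zero in norm while taking the value 1 at [M + 1], although the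
    evaluation there is bounded. *)
Lemma unbounded_supp (nu : borel_measure R) (a b : R) :
  H_indeterminate gamma -> H_representing gamma nu ->
  ~ (forall x, supp nu x -> a <= x <= b).
Proof.
move=> indet nu_rep supp_ab.
pose M := Num.max `|a| `|b|.
have M0 : 0 <= M by rewrite le_max normr_ge0.
have x0 : 0 < M + 1 by rewrite ltr_wpDl.
have [C evalC] := evaluation_bounded indet (M + 1).
have L1 := rep_L_sqr_ge0 nu_rep 1.
pose y := (M / (M + 1)) ^+ 2.
have y0 : 0 <= M / (M + 1) by rewrite divr_ge0// ltW.
have y1 : M / (M + 1) < 1 by rewrite ltr_pdivrMr// mul1r ltrDl.
pose N : set (measurableTypeR R) := ~` `[a, b]%classic.
have key n : 1 <= C * (y ^+ n * moment_functional gamma 1).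
  pose p : {poly R} := ((M + 1)^-1 *: 'X) ^+ n.
  have pE t : p.[t] = (t / (M + 1)) ^+ n.
    by rewrite /p horner_exp hornerZ hornerX mulrC.
  have := evalC p; rewrite pE mulfV ?gt_eqF// !expr1n => h; apply: (le_trans h).
  have C0 : 0 <= C.
    have h0 := rep_L_sqr_ge0 nu_rep p.
    rewrite leNgt; apply/negP => Cn; have := mulr_le0_ge0 (ltW Cn) h0; lra.
  rewrite ler_wpM2l//.
  have : 0 <= moment_functional gamma (y ^+ n *: 1 - p ^+ 2).
    apply: (L_ge0_of_nonneg_ae nu_rep (N := N)).
    - by apply: measurableC; exact: measurable_itv.
    - apply: null_of_disjoint_supp; first by apply: measurableC; exact: measurable_itv.
      by move=> x Nx /supp_ab xab; apply: Nx; rewrite /= in_itv.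
    - move=> t /contrapT /=; rewrite in_itv/= => /andP[at_ tb].
      rewrite hornerD hornerN hornerZ hornerC mulr1 horner_exp pE subr_ge0.
      rewrite -exprM mulnC exprM /y; apply: lerXn2r; rewrite ?nnegrE ?sqr_ge0//.
      rewrite -[leLHS]real_normK ?num_real// lerXn2r ?nnegrE//.
      rewrite normrM (gtr0_norm (_ : 0 < (M + 1)^-1)) ?invr_gt0//.
      rewrite ler_pM2r ?invr_gt0// ler_norml.
      have aM : `|a| <= M by rewrite le_max lexx.
      have bM : `|b| <= M by rewrite le_max lexx orbT.
      have := ler_norm b; have := ler_norm (- a); rewrite normrN => h1 h2.
      by apply/andP; split; lra.
  rewrite -[_ <= _ * _]subr_ge0; apply: etrans; congr (0 <= _).
  by rewrite linearB linearZ.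
have cv : C * (y ^+ n * moment_functional gamma 1) @[n --> \oo] -->
    C * (0 * moment_functional gamma 1).
  apply: cvgM; first exact: cvg_cst.
  apply: cvgM; last exact: cvg_cst.
  by apply: cvg_expr; rewrite ger0_norm ?sqr_ge0// exprn_ilt1.
have : 1 <= C * (0 * moment_functional gamma 1).
  by apply: (cvgr_to_ge cv); apply: nearW.
by rewrite mul0r mulr0 ler10.
Qed.

End NExtremalSupports.

Theorem theorem2p2p6 (R : realType) (gamma : nat -> R)
    (hmom : Hamburger_moment_sequence gamma)
    (hindet : H_indeterminate gamma) :
  exactly_one_of_three
    (forall nu : borel_measure R, N_extremal gamma nu ->
       inf_supp nu = -oo%E /\ sup_supp nu = +oo%E)
    (forall nu : borel_measure R, N_extremal gamma nu ->
       (-oo < inf_supp nu)%E /\ sup_supp nu = +oo%E)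
    (forall nu : borel_measure R, N_extremal gamma nu ->
       inf_supp nu = -oo%E /\ (sup_supp nu < +oo)%E).
Proof.
have [nu0 nu0_ext] := exists_N_extremal hindet.
have inf_transfer nu mu : N_extremal gamma nu -> N_extremal gamma mu ->
    (-oo < inf_supp nu)%E -> (-oo < inf_supp mu)%E.
  move=> [_ nu_rep _] mu_ext /supp_ge_of_inf[a ha]; rewrite ltNge leeNy_eq.
  apply/eqP => hmu.
  apply: (@semibounded_transfer R gamma nu mu 1 a) => //; rewrite ?expr1n//.
    by move=> x; rewrite mul1r; exact: ha.
  by move=> m; have [x sx xm] := supp_lt_of_inf m hmu; exists x; rewrite ?mul1r.
have sup_transfer nu mu : N_extremal gamma nu -> N_extremal gamma mu ->
    (sup_supp nu < +oo)%E -> (sup_supp mu < +oo)%E.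
  move=> [_ nu_rep _] mu_ext /supp_le_of_sup[b hb]; rewrite ltNge leye_eq.
  apply/eqP => hmu.
  apply: (@semibounded_transfer R gamma nu mu (-1) (- b)) => //; rewrite ?sqrrN ?expr1n//.
    by move=> x; rewrite mulN1r lerN2; exact: hb.
  move=> m; have [x sx mx] := supp_gt_of_sup (- m) hmu; exists x => //.
  by rewrite mulN1r ltrNl.
have not_both nu : N_extremal gamma nu -> (-oo < inf_supp nu)%E ->
    (sup_supp nu < +oo)%E -> False.
  move=> [_ nu_rep _] /supp_ge_of_inf[a ha] /supp_le_of_sup[b hb].
  apply: (unbounded_supp (a := a) (b := b) hindet nu_rep) => x sx.
  by rewrite ha// hb.
have infN (nu : borel_measure R) : inf_supp nu = -oo%E \/ (-oo < inf_supp nu)%E.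
  by have [/eqP|] := boolP (inf_supp nu == -oo%E); [left|right; rewrite ltNye].
have supY (nu : borel_measure R) : sup_supp nu = +oo%E \/ (sup_supp nu < +oo)%E.
  by have [/eqP|] := boolP (sup_supp nu == +oo%E); [left|right; rewrite ltey].
split.
- have [i0|i0] := infN nu0; last first.
    apply: Or32 => nu nu_ext; have inu := inf_transfer _ _ nu0_ext nu_ext i0.
    by split => //; have [//|snu] := supY nu; exfalso; exact: (not_both nu).
  have [s0|s0] := supY nu0; last first.
    apply: Or33 => nu nu_ext; have snu := sup_transfer _ _ nu0_ext nu_ext s0.
    by split => //; have [//|inu] := infN nu; exfalso; exact: (not_both nu).
  apply: Or31 => nu nu_ext; split.
    have [//|inu] := infN nu.
    by have := inf_transfer _ _ nu_ext nu0_ext inu; rewrite i0.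
  have [//|snu] := supY nu.
  by have := sup_transfer _ _ nu_ext nu0_ext snu; rewrite s0.
- by move=> [/(_ _ nu0_ext)[i0 _] /(_ _ nu0_ext)[+ _]]; rewrite i0.
- by move=> [/(_ _ nu0_ext)[_ s0] /(_ _ nu0_ext)[_]]; rewrite s0.
- by move=> [/(_ _ nu0_ext)[_ s0] /(_ _ nu0_ext)[_]]; rewrite s0.
Qed.
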